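(* Let $G(\Lambda)$ be a graph product of admissible groups, and assume that $\Lambda$ is anticonnected (so that the group does not split trivially as a product) and has at least $3$ vertices. Then $G(\Lambda)$ has exact exponential growth; that is, with $S$ the standard generating set of $G(\Lambda)$, there exist constants $\lambda>1$ and $c>0$ such that $$\lim_{n\to\infty}\frac{\#\{g\in G(\Lambda):|g|_S=n\}}{\lambda^n}=c.$$
   Context: Graph products: let $\Lambda$ be a finite simplicial graph and, for each vertex $v$ of $\Lambda$, let $G_v$ be a finitely generated group (the vertex group). The graph product $G(\Lambda)$ is the group generated by the vertex groups $G_v$ with the relations that two vertex groups commute when the corresponding vertices are joined by an edge, i.e. the quotient of the free product of the $G_v$ by the relations $[g,h]=1$ for all $g\in G_v$, $h\in G_w$ with $(v,w)$ an edge of $\Lambda$. It is a graph product of admissible groups if each $G_v$ is admissible (defined below); if $S_v$ is a finite generating set of $G_v$ for which $G_v$ has a geodesic combing, then the standard generating set of $G(\Lambda)$ is $S=\bigcup_v S_v$. $|\cdot|_S$ denotes word length with respect to $S$. The graph $\Lambda$ is anticonnected if its opposite graph (same vertex set, with two distinct vertices adjacent if and only if they are not adjacent in $\Lambda$) is connected. Admissible groups: a graph structure $(G,\Gamma)$ consists of a countable group $G$ and a finite directed graph $\Gamma$ with an initial vertex $v_0$ from which every other vertex is reachable by a directed path, and with edges labeled by elements of $G$ so that distinct edges out of a fixed vertex have distinct labels. The evaluation map $\mathrm{ev}$ sends a finite path to the product of its edge labels, and $\Omega_0$ is the set of finite paths starting at $v_0$. It is a geodesic combing with respect to $S=\mathrm{ev}(E(\Gamma))$,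 where $E(\Gamma)$ is the edge set, if $\mathrm{ev}:\Omega_0\to G$ is a bijection and $|\mathrm{ev}(p)|_S$ equals the length of $p$ for every finite path $p$ in $\Gamma$. A group is admissible if it has a geodesic combing with respect to some finite generating set.
   Formalization: All vertex groups are assumed nontrivial; without this the claim fails, e.g. for three vertices with no edges and vertex groups Z/2, Z/2, 1, where the graph product is the infinite dihedral group with linear growth. *)

(* Defs.v *)
From HB Require Import structures.
From mathcomp Require Import all_boot all_order all_algebra.
From mathcomp Require Import all_classical all_reals all_analysis.

Set Implicit Arguments.
Unset Strict Implicit.
Unset Printing Implicit Defensive.

Local Open Scope classical_set_scope.
Local Open Scope group_scope.

Section WordLength.
Variables (G : groupType) (S : set G).

(* A word may use inverses of generators: [S] is not assumed symmetric. *)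
Definition word_over (w : seq G) : Prop :=
  forall s, s \in w -> S s \/ S s^-1.

Definition has_word (g : G) (n : nat) : Prop :=
  exists w : seq G, [/\ word_over w, size w = n & \big[*%g/1]_(s <- w) s = g].

Definition generates : Prop := forall g : G, exists n, has_word g n.

(* |g|_S = n, as a relation because |g|_S is undefined when g is not in the
   subgroup generated by S. *)
Definition word_length (g : G) (n : nat) : Prop :=
  has_word g n /\ forall m, has_word g m -> (n <= m)%N.

Definition sphere (n : nat) : set G := [set g | word_length g n].

End WordLength.

Section Walk.
Variables (V E : Type) (src tgt : E -> V).

(* [walk v p w]: [p] is the edge sequence of a directed path from [v] to [w]. *)
Fixpoint walk (v : V) (p : seq E) (w : V) : Prop :=
  if p is e :: p' then src e = v /\ walk (tgt e) p' w else v = w.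

End Walk.

(* Edges form a type of their own, so that parallel edges are allowed. *)
Record graph_structure (G : groupType) := GraphStructure {
  gs_vertex : finType;
  gs_edge : finType;
  gs_src : gs_edge -> gs_vertex;
  gs_tgt : gs_edge -> gs_vertex;
  gs_label : gs_edge -> G;
  gs_init : gs_vertex;
  gs_countable : countable [set: G];
  gs_reachable :
    forall v, exists p, walk gs_src gs_tgt gs_init p v;
  gs_label_inj :
    forall e f, gs_src e = gs_src f -> gs_label e = gs_label f -> e = f
}.

Section Combing.
Variables (G : groupType) (Gamma : graph_structure G).

Definition is_path_from (v : gs_vertex Gamma) (p : seq (gs_edge Gamma)) : Prop :=
  exists w, walk (@gs_src _ Gamma) (@gs_tgt _ Gamma) v p w.

Definition ev (p : seq (gs_edge Gamma)) : G := \big[*%g/1]_(e <- p) gs_label e.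

Definition Omega0 : set (seq (gs_edge Gamma)) :=
  [set p | is_path_from (gs_init Gamma) p].

Definition is_geodesic_combing (S : set G) : Prop :=
  [/\ S = range (@gs_label _ Gamma),
      set_bij Omega0 [set: G] ev &
      forall v p, is_path_from v p -> word_length S (ev p) (size p)].

End Combing.

Definition admissible_wrt (G : groupType) (S : set G) : Prop :=
  [/\ finite_set S, generates S &
      exists Gamma : graph_structure G, is_geodesic_combing Gamma S].

Definition admissible (G : groupType) : Prop :=
  exists S : set G, admissible_wrt S.

Section GraphProduct.
Variables (V : finType) (adj : rel V) (G : V -> groupType).

Definition letter : Type := {v : V & G v}.
HB.instance Definition _ := Choice.on letter.

Definition mkletter (v : V) (g : G v) : letter := Tagged (fun v => G v : Type) g.

(* The congruence on words defining the quotient: [gp_eqv_unit] and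
   [gp_eqv_mul] give the free product of the [G v], [gp_eqv_comm] imposes
   [g, h] = 1 along the edges. *)
Inductive gp_eqv : seq letter -> seq letter -> Prop :=
| gp_eqv_refl a : gp_eqv a a
| gp_eqv_sym a b : gp_eqv a b -> gp_eqv b a
| gp_eqv_trans a b c : gp_eqv a b -> gp_eqv b c -> gp_eqv a c
| gp_eqv_cat a a' b b' : gp_eqv a a' -> gp_eqv b b' -> gp_eqv (a ++ b) (a' ++ b')
| gp_eqv_unit v : gp_eqv [:: mkletter (1 : G v)] [::]
| gp_eqv_mul v (g h : G v) :
    gp_eqv [:: mkletter g; mkletter h] [:: mkletter (g * h)]
| gp_eqv_comm v w (g : G v) (h : G w) : adj v w ->
    gp_eqv [:: mkletter g; mkletter h] [:: mkletter h; mkletter g].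

Definition gp_eqb : rel (seq letter) := fun a b => `[< gp_eqv a b >].

Lemma gp_eqb_refl : reflexive gp_eqb.
Proof. by move=> a; apply/asboolP/gp_eqv_refl. Qed.

Lemma gp_eqb_sym : symmetric gp_eqb.
Proof.
by move=> a b; apply/idP/idP => /asboolP ab; apply/asboolP/gp_eqv_sym.
Qed.

Lemma gp_eqb_trans : transitive gp_eqb.
Proof.
by move=> b a c /asboolP ab /asboolP bc; apply/asboolP/(gp_eqv_trans ab).
Qed.

Canonical gp_equiv := EquivRel gp_eqb gp_eqb_refl gp_eqb_sym gp_eqb_trans.

Definition gprod : Type := {eq_quot gp_equiv}%qT.
HB.instance Definition _ := Choice.on gprod.
HB.instance Definition _ := EqQuotient.on gprod.

Definition gp_class (a : seq letter) : gprod := (\pi_gprod a)%qT.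

Lemma gp_classP a b : gp_class a = gp_class b <-> gp_eqv a b.
Proof.
split=> [ab|ab]; first exact/asboolP/(@eqmodP _ gp_equiv).
exact/(@eqmodP _ gp_equiv)/asboolP.
Qed.

Lemma gp_classK (x : gprod) : gp_class (repr x) = x.
Proof. exact: reprK. Qed.

Definition letter_inv (l : letter) : letter := mkletter (tagged l)^-1.
Definition word_inv (a : seq letter) : seq letter := rev (map letter_inv a).

Definition gp_one : gprod := gp_class [::].
Definition gp_mul (x y : gprod) : gprod := gp_class (repr x ++ repr y).
Definition gp_inv (x : gprod) : gprod := gp_class (word_inv (repr x)).

Lemma gp_eqv_repr a : gp_eqv (repr (gp_class a)) a.
Proof. by apply/gp_classP; rewrite gp_classK. Qed.

Lemma gp_mulE a b : gp_mul (gp_class a) (gp_class b) = gp_class (a ++ b).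
Proof. by apply/gp_classP/gp_eqv_cat; exact: gp_eqv_repr. Qed.

Lemma word_invVl a : gp_eqv (word_inv a ++ a) [::].
Proof.
elim: a => [|l a IHa]; first exact: gp_eqv_refl.
rewrite /word_inv map_cons rev_cons cat_rcons -/(word_inv a).
apply: gp_eqv_trans IHa; apply: gp_eqv_cat; first exact: gp_eqv_refl.
apply: (@gp_eqv_cat [:: letter_inv l; l] [::]); last exact: gp_eqv_refl.
case: l => v g.
apply: gp_eqv_trans (gp_eqv_unit v).
by rewrite -(mulVg g); apply: gp_eqv_mul.
Qed.

Lemma gp_mulA : associative gp_mul.
Proof.
move=> x y z; rewrite -[x]gp_classK -[y]gp_classK -[z]gp_classK.
by rewrite !gp_mulE catA.
Qed.

Lemma gp_mul1 : left_id gp_one gp_mul.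
Proof. by move=> x; rewrite -[x]gp_classK gp_mulE. Qed.

Lemma gp_mulr1 : right_id gp_one gp_mul.
Proof. by move=> x; rewrite -[x]gp_classK gp_mulE cats0. Qed.

Lemma gp_mulV : left_inverse gp_one gp_inv gp_mul.
Proof.
by move=> x; rewrite -[x in gp_mul _ x]gp_classK gp_mulE; apply/gp_classP/word_invVl.
Qed.

Lemma gp_mulrV : right_inverse gp_one gp_inv gp_mul.
Proof.
move=> x; rewrite -[LHS]gp_mul1 -{1}(gp_mulV (gp_inv x)) -gp_mulA.
by rewrite (gp_mulA (gp_inv x)) gp_mulV gp_mul1 gp_mulV.
Qed.

HB.instance Definition _ :=
  isGroup.Build gprod gp_mulA gp_mul1 gp_mulr1 gp_mulV gp_mulrV.

Definition gp_in (v : V) (g : G v) : gprod := gp_class [:: mkletter g].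

Definition standard_generators (S : forall v, set (G v)) : set gprod :=
  \bigcup_v (gp_in (v := v) @` S v).

End GraphProduct.

Arguments gprod {V} adj G.
Arguments gp_in {V} adj {G} v g.
Arguments standard_generators {V} adj {G} S.

Definition simplicial_graph (V : finType) (adj : rel V) : Prop :=
  symmetric adj /\ irreflexive adj.

Definition opposite (V : finType) (adj : rel V) : rel V :=
  [rel v w | (v != w) && ~~ adj v w].

Definition connected_graph (V : finType) (adj : rel V) : Prop :=
  forall v w, connect adj v w.

Definition anticonnected (V : finType) (adj : rel V) : Prop :=
  connected_graph (opposite adj).

(* Main.v *)
Require Import Defs.
From HB Require Import structures.
From mathcomp Require Import all_boot all_order all_algebra.
From mathcomp Require Import finmap.
From mathcomp Require Import all_classical all_reals all_analysis.
From mathcomp Require Import ring lra zify.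
Import Order.TTheory GRing.Theory Num.Theory numFieldNormedType.Exports.
Set Implicit Arguments.
Unset Strict Implicit.
Unset Printing Implicit Defensive.
Local Open Scope classical_set_scope.

(** The proof isolates one vertex [v0] and reads off a renewal equation for the
    numbers of elements of each length; the renewal theorem then gives the
    exact asymptotics.

    Write every element as a reduced product of syllables, and say that a vertex
    is exposed in it when one of its syllables can be shuffled to the front.
    Let A be the elements with no syllable in [v0] ([vertex_free]), Q the elements
    in which only [v0] may be exposed ([vertex_headed]), X the nontrivial elements
    of the vertex group of [v0] ([vertex_syllable]), and T the nontrivial elements
    of A none of whose exposed vertices is a neighbour of [v0] ([separator]).
    Word length is additive on reduced products, and uniquely G = A Q ([cnt_setT]) and
    Q = G_v0 + X T Q, a disjoint union ([vertex_headed_cover]).  In terms of growth series,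

      g = a q   and   q = (1 + x) + u q   with u = x t.

    As u has nonnegative coefficients, if u(r) = 1 for some r smaller than the
    radii of convergence of a and x, the numbers u_n r^n form a probability
    distribution with finite mean.  Its support contains 2 and 3, because the
    opposite graph is connected on at least three vertices, so it is aperiodic.
    The renewal theorem makes q_n r^n converge to a positive limit, and then
    g_n r^n converges as well.  The sum of all u_n is at least 2, so r < 1 and the
    growth rate 1/r exceeds 1.

    The remaining point is the existence of r ([renewal_sum_gt1]).  The series a
    and 1 + x have submultiplicative coefficients, so the set of points where
    both converge is open.  Were u at most 1 on this set within [0, 1], both x
    and t would be bounded there, away from 0.  Connectedness of the opposite graph lets one
    move any element of A into T by multiplying it on the left by boundedly many
    generators ([reach_separator]), so a would be bounded too; the set would then
    be closed as well, hence would contain 1, where u is at least 2.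

    Syllable combinatorics rests on pilings: an element is recorded by one stack
    for each vertex, on which a syllable of that vertex pushes itself and a
    syllable of a non-neighbour pushes a blank.  Shuffling commuting syllables
    does not change the stacks, so they are a normal form without any choice of
    order ([rep_stkE]). *)

(** * Word length *)

Section WordLen.
Local Open Scope group_scope.
Variables (G : groupType) (S : set G).

Lemma has_word1 : has_word S 1 0.
Proof. by exists [::]; rewrite big_nil; split. Qed.

Lemma has_wordM g h m n : has_word S g m -> has_word S h n -> has_word S (g * h) (m + n).
Proof.
move=> [a [aS <- <-]] [b [bS <- <-]]; exists (a ++ b); split.
- by move=> s; rewrite mem_cat => /orP[/aS|/bS].
- exact: size_cat.
- by rewrite big_cat.
Qed.

Lemma has_word_gen s : S s \/ S s^-1 -> has_word S s 1.
Proof. by move=> Ss; exists [:: s]; rewrite big_seq1; split=> // t /[!inE] /eqP ->. Qed.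

Lemma has_word_cons g n : has_word S g n.+1 ->
  exists s h, [/\ S s \/ S s^-1, has_word S h n & g = s * h].
Proof.
move=> [[|s a] [//= aS [<-] <-]]; exists s, (\prod_(t <- a) t).
split; [by apply: aS; rewrite mem_head| |by rewrite big_cons].
by exists a; split=> // t ta; apply: aS; rewrite inE ta orbT.
Qed.

Hypothesis gen : generates S.

Lemma has_word_ex g : exists n, `[<has_word S g n>].
Proof. by have [n] := gen g; exists n; apply/asboolP. Qed.

Definition wlen g : nat := ex_minn (has_word_ex g).

Lemma wlenP g : has_word S g (wlen g).
Proof. by rewrite /wlen; case: ex_minnP => n /asboolP. Qed.

Lemma wlen_min g n : has_word S g n -> (wlen g <= n)%N.
Proof. by rewrite /wlen; case: ex_minnP => m _ mn gn; apply: mn; apply/asboolP. Qed.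

Lemma word_lengthE g n : word_length S g n <-> wlen g = n.
Proof.
split=> [[gn nm]|<-]; last by split; [exact: wlenP|exact: wlen_min].
by apply/anti_leq; rewrite wlen_min //= nm //; apply: wlenP.
Qed.

Lemma wlenM g h : (wlen (g * h) <= wlen g + wlen h)%N.
Proof. by apply: wlen_min; apply: has_wordM; apply: wlenP. Qed.

Lemma wlen1 : wlen 1 = 0%N.
Proof. by apply/eqP; rewrite -leqn0 wlen_min //; apply: has_word1. Qed.

Lemma wlen_eq0 g : wlen g = 0%N -> g = 1.
Proof.
move=> g0; have := wlenP g; rewrite g0 => -[[|s a] [_ //= _ <-]].
by rewrite big_nil.
Qed.

Lemma wlen_split g n : wlen g = n.+1 ->
  exists s h, [/\ wlen s = 1%N, wlen h = n & g = s * h].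
Proof.
move=> gn; have := wlenP g; rewrite gn => /has_word_cons[s [h [Ss hn gE]]].
exists s, h; split=> //.
  apply/anti_leq; rewrite wlen_min /=; last exact: has_word_gen.
  by have := wlenM s h; rewrite -gE gn; have := wlen_min hn; lia.
apply/anti_leq; rewrite wlen_min //=; have := wlenM s h; rewrite -gE gn.
by have := wlen_min (has_word_gen Ss); lia.
Qed.

Lemma has_word_finite n : finite_set S -> finite_set [set g | has_word S g n].
Proof.
move=> Sf; elim: n => [|n IH].
  apply: (@sub_finite_set _ _ [set 1]); last exact: finite_set1.
  by move=> g [[|s a] [_ //= _ <-]]; rewrite big_nil.
pose S' := S `|` (fun g => g^-1) @` S.
have S'f : finite_set S' by rewrite finite_setU; split=> //; apply: finite_image.
apply: sub_finite_set (finite_image2 (fun s h => s * h) S'f IH).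
move=> g /has_word_cons[s [h [Ss hn ->]]]; exists s; last by exists h.
by case: Ss => Ss; [left|right; exists s^-1; rewrite ?invgK].
Qed.

End WordLen.

(** * Counting elements of given length *)

Section Counting.
Local Open Scope group_scope.
Variables (G : groupType) (S : set G).
Hypotheses (S_finite : finite_set S) (gen : generates S).
Local Notation len := (wlen gen).
Implicit Types (X Y Z : set G).

(** The finite-set form of the part of [X] on the sphere of radius [n]; it is
    meaningful because the spheres are finite, see [in_slice]. *)
Definition slice X n : {fset G} := fset_set (X `&` sphere S n).
Definition cnt X n : nat := #|` slice X n|%fset.

Lemma in_slice X n x : (x \in slice X n) = `[< X x /\ len x = n >].
Proof.
rewrite /slice in_fset_set; last first.
  by apply: sub_finite_set (has_word_finite n S_finite) => y [_ []].
apply/idP/asboolP; rewrite inE /=.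
  by move=> [Xx /(word_lengthE gen)].
by move=> [Xx /(word_lengthE gen)].
Qed.

Lemma slice_uniq X n : uniq (slice X n). Proof. exact: fset_uniq. Qed.

Lemma eq_cnt X Y n : (forall x, len x = n -> X x <-> Y x) -> cnt X n = cnt Y n.
Proof.
move=> XY; congr #|` _|%fset; apply/fsetP => x; rewrite !in_slice.
by apply/asboolP/asboolP => -[Xx xn]; split=> //; apply/(XY x xn).
Qed.

Lemma cnt_gt0 X x : X x -> (0 < cnt X (len x))%N.
Proof.
move=> Xx; rewrite cardfs_gt0; apply/fset0Pn; exists x.
by rewrite in_slice; apply/asboolP.
Qed.

Lemma cnt_le X Y n : (forall x, len x = n -> X x -> Y x) -> (cnt X n <= cnt Y n)%N.
Proof.
move=> XY; apply: fsubset_leq_card; apply/fsubsetP => x; rewrite !in_slice.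
by move=> /asboolP[Xx xn]; apply/asboolP; split=> //; apply: XY.
Qed.

Lemma cntU X Y n : (forall x, X x -> Y x -> False) ->
  cnt (X `|` Y) n = (cnt X n + cnt Y n)%N.
Proof.
move=> XY; rewrite /cnt -cardfsUI.
have -> : (slice X n `&` slice Y n = fset0)%fset.
  apply/fsetP => x; rewrite !inE !in_slice.
  apply/negP => /andP[/asboolP[Xx _] /asboolP[Yx _]].
  exact: XY Xx Yx.
rewrite cardfs0 addn0; congr #|` _|%fset; apply/fsetP => x.
rewrite inE !in_slice; apply/asboolP/orP.
  by move=> [[Xx|Yx] xn]; [left|right]; apply/asboolP.
by move=> [] /asboolP[Xx xn]; split=> //; [left|right].
Qed.

Lemma cnt_submult X Y Z m n :
  (forall z, Z z -> len z = (m + n)%N ->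
     exists x y, [/\ X x, Y y, len x = m, len y = n & z = x * y]) ->
  (cnt Z (m + n) <= cnt X m * cnt Y n)%N.
Proof.
move=> ZXY; rewrite -(size_allpairs (fun x y => x * y) (slice X m) (slice Y n)).
apply: uniq_leq_size => [|z]; first exact: slice_uniq.
rewrite in_slice => /asboolP[Zz /(ZXY z Zz)[x [y [Xx Yy xm yn ->]]]].
by apply: (allpairs_f (fun x y => x * y)); rewrite in_slice; apply/asboolP.
Qed.

(** Each [x] is recovered from the index [i] and the element [h i * x] of [Y],
    so there are at most as many [x] as such pairs. *)
Lemma cnt_cover (I : finType) (h : I -> G) X Y m n :
  (forall x, X x -> len x = m -> exists i, Y (h i * x) /\ len (h i * x) = n) ->
  (cnt X m <= #|I| * cnt Y n)%N.
Proof.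
move=> XY; rewrite cardE -(size_allpairs (fun i y => (h i)^-1 * y) (enum I) (slice Y n)).
apply: uniq_leq_size => [|x]; first exact: slice_uniq.
rewrite in_slice => /asboolP[Xx /(XY x Xx)[i [Yy yn]]].
rewrite -[x](mulKg (h i)); apply: (allpairs_f (fun i y => (h i)^-1 * y)).
  by rewrite mem_enum.
by rewrite in_slice; apply/asboolP.
Qed.

Lemma cnt_union M (Y : nat -> set G) X n :
  (forall x, X x -> len x = n -> exists2 j, (j < M)%N & Y j x) ->
  (cnt X n <= \sum_(j < M) cnt (Y j) n)%N.
Proof.
move=> XY; pose L := flatten [seq (slice (Y j) n : seq G) | j <- iota 0 M].
have -> : (\sum_(j < M) cnt (Y j) n = size L)%N.
  rewrite size_flatten /shape -map_comp sumnE big_map.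
  rewrite -(big_mkord xpredT (fun j => cnt (Y j) n)).
  by rewrite /index_iota subn0.
apply: uniq_leq_size => [|x]; first exact: slice_uniq.
rewrite in_slice => /asboolP[Xx xn]; have [j jM Yx] := XY x Xx xn.
apply/flattenP; exists (slice (Y j) n : seq G); last by rewrite in_slice; apply/asboolP.
by apply/mapP; exists j; rewrite // mem_iota.
Qed.

(** Unique length-additive factorisation turns into a Cauchy product: classify
    the elements of [Z] by the length of their first factor. *)
Lemma cnt_mul X Y Z n :
  (forall x y, X x -> Y y -> Z (x * y) /\ len (x * y) = (len x + len y)%N) ->
  (forall z, Z z -> exists x y, [/\ X x, Y y & z = x * y]) ->
  (forall x y x' y', X x -> Y y -> X x' -> Y y' -> x * y = x' * y' -> x = x') ->
  cnt Z n = (\sum_(k < n.+1) cnt X k * cnt Y (n - k))%N.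
Proof.
move=> XYZ ZXY XYinj.
(* [f z] is the first factor of [z]. *)
pose f z := xget 1 [set x | X x /\ Y (x^-1 * z)].
have fE x y : X x -> Y y -> f (x * y) = x.
  move=> Xx Yy; rewrite /f; case: xgetP => [x' _ [Xx' Yy']|/(_ x)].
    by apply: (XYinj _ _ _ _ Xx' Yy' Xx Yy); rewrite mulVKg.
  by case; split=> //; rewrite mulKg.
rewrite [LHS](_ : _ = size (slice Z n : seq G)) // -sum1_size.
rewrite (partition_big (fun z => inord (len (f z)) : 'I_n.+1) xpredT) //=.
apply: eq_bigr => k _; rewrite -big_filter sum1_size.
rewrite -(size_allpairs (fun x y => x * y) (slice X k) (slice Y (n - k))).
have kn : (k <= n)%N by rewrite -ltnS.
apply/perm_size/uniq_perm; first by rewrite filter_uniq // slice_uniq.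
  apply: allpairs_uniq; rewrite ?slice_uniq // => -[x y] [x' y'] /=.
  move=> /allpairsP[[a b] /= [+ + [-> ->]]].
  rewrite !in_slice => /asboolP[Xx _] /asboolP[Yy _].
  move=> /allpairsP[[a' b'] /= [+ + [-> ->]]].
  rewrite !in_slice => /asboolP[Xx' _] /asboolP[Yy' _].
  move=> E; have xx' := XYinj _ _ _ _ Xx Yy Xx' Yy' E; subst a'.
  by rewrite (mulgI _ _ _ E).
move=> z; rewrite mem_filter in_slice; apply/andP/allpairsP.
  move=> [/eqP fz /asboolP[Zz zn]]; have [x [y [Xx Yy zE]]] := ZXY z Zz.
  have [_ lz] := XYZ x y Xx Yy; rewrite -zE zn in lz.
  have xk : len x = k.
    have := congr1 val fz; rewrite /= zE fE // inordK // ltnS; lia.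
  by exists (x, y) => /=; rewrite !in_slice; split=> //; apply/asboolP; split=> //; lia.
move=> [[x y] /= [+ + ->]]; rewrite !in_slice => /asboolP[Xx xk] /asboolP[Yy yk].
have [Zz lz] := XYZ x y Xx Yy; rewrite fE // xk inord_val eqxx; split=> //.
by apply/asboolP; split=> //; rewrite lz xk yk subnKC.
Qed.

End Counting.

(** * Pilings: a normal form for graph products *)

Section Pilings.
Local Open Scope group_scope.
Variables (V : finType) (adj : rel V) (G : V -> groupType).
Hypotheses (adj_sym : symmetric adj) (adj_irr : irreflexive adj).
Local Notation letter := (letter G).
Local Notation gprod := (gprod adj G).
Implicit Types (l k : letter) (u v w : V) (B : pred V) (x y : gprod).

Definition gp_letter (l : letter) : gprod := gp_in adj (tag l) (tagged l).

Lemma gp_in1 v : gp_in adj v (1 : G v) = 1.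
Proof. exact/gp_classP/gp_eqv_unit. Qed.

Lemma gp_inM v (g h : G v) : gp_in adj v (g * h) = gp_in adj v g * gp_in adj v h.
Proof. by rewrite [RHS]gp_mulE; apply/gp_classP/gp_eqv_sym/gp_eqv_mul. Qed.

Lemma gp_inV v (g : G v) : gp_in adj v g^-1 = (gp_in adj v g)^-1.
Proof. by apply: (mulgI (gp_in adj v g)); rewrite -gp_inM !mulgV gp_in1. Qed.

Lemma gp_in_comm v w (g : G v) (h : G w) : adj v w ->
  gp_in adj v g * gp_in adj w h = gp_in adj w h * gp_in adj v g.
Proof. by move=> vw; rewrite [LHS]gp_mulE [RHS]gp_mulE; apply/gp_classP/gp_eqv_comm. Qed.

(** One stack for each vertex, with the head of the list on top and [None] for a
    blank. *)
Definition piling := V -> seq (option letter).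

(** A syllable [l] leaves a trace on every stack whose vertex fails to commute
    with it, so the stacks remember the order of non-commuting syllables only. *)
Definition push (l : letter) (s : piling) : piling := fun u =>
  if adj (tag l) u then s u
  else (if u == tag l then Some l else None) :: s u.

Definition pop v (s : piling) : piling := fun u =>
  if adj v u then s u else behead (s u).

Definition top (s : piling) v : option letter := head None (s v).

Lemma top_push l s u : top (push l s) u =
  if adj (tag l) u then top s u else if u == tag l then Some l else None.
Proof. by rewrite /top /push; case: ifP. Qed.

Lemma top_push_eq l s : top (push l s) (tag l) = Some l.
Proof. by rewrite top_push adj_irr eqxx. Qed.

Lemma pop_push l s : pop (tag l) (push l s) = s.
Proof. by apply/funext => u; rewrite /pop /push; case: (adj (tag l) u). Qed.

Lemma pushC k l s : adj (tag k) (tag l) -> push k (push l s) = push l (push k s).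
Proof.
move=> kl; apply/funext => u; rewrite /push.
case ku: (adj (tag k) u); case lu: (adj (tag l) u) => //.
case: eqP => [uk|_]; first by rewrite uk adj_sym kl in lu.
by case: eqP => [ul|//]; rewrite ul kl in ku.
Qed.

(** [rep s x]: the piling [s] is built by the syllables of a reduced expression
    of [x].  The side condition on [top] says that the new syllable does not
    merge with an earlier one. *)
Inductive rep : piling -> gprod -> Prop :=
| rep_nil : rep (fun=> [::]) 1
| rep_push (l : letter) s x : rep s x -> top s (tag l) = None -> tagged l <> 1 ->
    rep (push l s) (gp_letter l * x).

(** Any syllable lying on top of its stack could have been pushed last: by
    induction, the syllables pushed after it belong to neighbours of its vertex,
    and commute with it both in the group and as operations on stacks. *)
Lemma rep_pop s x v l : rep s x -> top s v = Some l ->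
  [/\ tag l = v, tagged l <> 1, rep (pop v s) ((gp_letter l)^-1 * x),
      top (pop v s) v = None & push l (pop v s) = s].
Proof.
move=> sx; elim: sx v l => {s x} [//|k s x sx IH sk k1] v l.
rewrite top_push; case: ifPn => [kv sv|kv].
  have [lv l1 s'x s'v s'E] := IH v l sv; subst v.
  have popk : pop (tag l) (push k s) = push k (pop (tag l) s).
    apply/funext => u; rewrite -{1}s'E pushC // -[k in RHS]/k.
    by have -> := congr1 (fun s => s u) (pop_push l (push k (pop (tag l) s))).
  split=> //.
  - rewrite popk mulgA -gp_inV gp_in_comm 1?adj_sym // gp_inV -mulgA.
    by apply: rep_push => //; rewrite /top /pop adj_sym kv.
  - by rewrite popk top_push kv.
  - by rewrite popk -pushC // s'E.
case: eqP => // -> [<-]; split=> //; rewrite ?pop_push // mulKg //.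
Qed.

Lemma rep_top_None s x : rep s x -> (forall v, top s v = None) -> x = 1.
Proof. by case=> // l s' y _ _ _ /(_ (tag l)); rewrite top_push_eq. Qed.

(** [head_at] and [behead_at] split off the possibly trivial syllable of [v] that
    can be shuffled to the front.  On pilings of the form [push_at h s] with no
    syllable of [v] on top of [s], the action of [g] is then simply
    [push_at (g * h) s], which makes the group relations immediate. *)
Definition head_at v (s : piling) : G v :=
  if top s v is Some l then tagged_as (mkletter (1 : G v)) l else 1.
Definition behead_at v (s : piling) : piling := if top s v then pop v s else s.
Definition push_at v (g : G v) (s : piling) : piling :=
  if g == 1 then s else push (mkletter g) s.
Definition act v (g : G v) (s : piling) : piling :=
  push_at (g * head_at v s) (behead_at v s).

Lemma rep_push_at s x v (g : G v) : rep s x -> top s v = None ->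
  rep (push_at g s) (gp_in adj v g * x).
Proof.
move=> sx sv; rewrite /push_at; case: eqP => [->|g1]; first by rewrite gp_in1 mul1g.
exact: (@rep_push (mkletter g)).
Qed.

Lemma rep_split v s x : rep s x ->
  [/\ rep (behead_at v s) ((gp_in adj v (head_at v s))^-1 * x),
      top (behead_at v s) v = None & push_at (head_at v s) (behead_at v s) = s].
Proof.
move=> sx; rewrite /head_at /behead_at; case sv: (top s v) => [l|] /=.
  have [lv l1 s'x s'v s'E] := rep_pop sx sv.
  case: l lv {sv} l1 s'x s'E => w g /= wv; subst w; rewrite tagged_asE /= => g1 s'x s'E.
  by split=> //; rewrite /push_at; case: eqP => // _; exact: s'E.
by rewrite gp_in1 invg1 mul1g /push_at eqxx; split.
Qed.

Lemma rep_act s x v (g : G v) : rep s x -> rep (act g s) (gp_in adj v g * x).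
Proof.
move=> /(rep_split v)[s'x s'v _].
by have := rep_push_at (g * head_at v s) s'x s'v; rewrite gp_inM mulgA mulgK.
Qed.

Lemma act_push_at s v (g h : G v) : top s v = None ->
  act g (push_at h s) = push_at (g * h) s.
Proof.
move=> sv; rewrite /act; suff [-> ->] :
  head_at v (push_at h s) = h /\ behead_at v (push_at h s) = s by [].
rewrite /head_at /behead_at /push_at; case: eqP => [->|_]; first by rewrite sv.
rewrite -[v in top _ v]/(tag (mkletter h)) top_push_eq tagged_asE; split=> //=.
exact: (pop_push (mkletter h)).
Qed.

Lemma actM s x v (g h : G v) : rep s x -> act g (act h s) = act (g * h) s.
Proof.
by move=> /(rep_split v)[_ s'v _]; rewrite {2}/act act_push_at // mulgA.
Qed.

Lemma act1 s x v : rep s x -> act (1 : G v) s = s.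
Proof. by move=> /(rep_split v)[_ _ s'E]; rewrite /act mul1g s'E. Qed.

Lemma top_push_at s v w (g : G v) : adj v w -> top (push_at g s) w = top s w.
Proof. by move=> vw; rewrite /push_at; case: eqP => // _; rewrite top_push /= vw. Qed.

Lemma push_atC s v w (g : G v) (h : G w) : adj v w ->
  push_at g (push_at h s) = push_at h (push_at g s).
Proof. by move=> vw; rewrite /push_at; do 2!case: eqP => //= _; rewrite pushC. Qed.

(** After splitting off the syllables of both [v] and [w], each action changes
    only its own syllable, and pushes on adjacent vertices commute. *)
Lemma actC s x v w (g : G v) (h : G w) : rep s x -> adj v w ->
  act g (act h s) = act h (act g s).
Proof.
move=> sx vw; have wv : adj w v by rewrite adj_sym.
have [s'x s'v <-] := rep_split v sx; have [_ tw <-] := rep_split w s'x.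
set t := behead_at w _; set a := head_at v s; set b := head_at w _.
have tv : top t v = None.
  have [_ _ E] := rep_split w s'x; rewrite -[LHS](@top_push_at _ w v b) //.
  by rewrite E.
rewrite !(@push_atC _ v w) // !act_push_at ?top_push_at //.
rewrite -[push_at (h * b) _](@push_atC _ v w) // -[push_at b _](@push_atC _ v w) //.
rewrite !act_push_at ?top_push_at // [in RHS](@push_atC _ v w) //.
by rewrite act_push_at ?top_push_at // push_atC.
Qed.

Definition pile (a : seq letter) (s : piling) : piling :=
  foldr (fun l => act (tagged l)) s a.

Lemma pile_cat a b s : pile (a ++ b) s = pile a (pile b s).
Proof. by rewrite /pile foldr_cat. Qed.

Lemma gp_class_cons l a : gp_class adj (l :: a) = gp_letter l * gp_class adj a.
Proof. by rewrite [RHS]gp_mulE; case: l. Qed.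

Lemma gp_class_nil : gp_class adj (G := G) [::] = 1.
Proof. by []. Qed.

Lemma rep_pile a s x : rep s x -> rep (pile a s) (gp_class adj a * x).
Proof.
move=> sx; elim: a => [|l a IH] /=; first by rewrite gp_class_nil mul1g.
by rewrite gp_class_cons -mulgA; apply: rep_act.
Qed.

(** The action on pilings respects the defining relations, hence factors through
    the graph product. *)
Lemma pile_eqv a b : gp_eqv adj a b -> forall s x, rep s x -> pile a s = pile b s.
Proof.
elim=> {a b} //.
- by move=> a b _ IH s x sx; rewrite (IH s x).
- by move=> a b c _ IH1 _ IH2 s x sx; rewrite (IH1 s x sx) (IH2 s x).
- move=> a a' b b' _ IH1 _ IH2 s x sx; rewrite !pile_cat (IH2 s x sx).
  exact/IH1/rep_pile/sx.
- by move=> v s x; apply: act1.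
- by move=> v g h s x; apply: actM.
- by move=> v w g h vw s x sx; apply: (actC _ _ sx).
Qed.

(** The piling of an element: let it act on the empty piling. *)
Definition stk (x : gprod) : piling := pile (repr x) (fun=> [::]).

Lemma rep_stk x : rep (stk x) x.
Proof. by have := rep_pile (repr x) rep_nil; rewrite gp_classK mulg1. Qed.

Lemma stk_class a : stk (gp_class adj a) = pile a (fun=> [::]).
Proof. by apply: (pile_eqv _ rep_nil); apply: gp_eqv_repr. Qed.

Lemma stk_in v (g : G v) x : stk (gp_in adj v g * x) = act g (stk x).
Proof. by rewrite -[x]gp_classK -(gp_class_cons (mkletter g)) !stk_class. Qed.

Lemma stk1 : stk 1 = fun=> [::].
Proof. exact: stk_class. Qed.

Definition exposed v x : bool := top (stk x) v.

Lemma exposedPn v x : reflect (top (stk x) v = None) (~~ exposed v x).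
Proof. by rewrite /exposed; case: (top _ _); constructor. Qed.

Lemma stk_push v (g : G v) x : g <> 1 -> ~~ exposed v x ->
  stk (gp_in adj v g * x) = push (mkletter g) (stk x).
Proof.
move=> g1 /exposedPn vx; have [_ _] := rep_split v (rep_stk x).
rewrite stk_in /act /head_at /behead_at vx mulg1 /push_at => _.
by case: eqP.
Qed.

Lemma exposed_push v (g : G v) x u : g <> 1 -> ~~ exposed v x ->
  exposed u (gp_in adj v g * x) = (u == v) || adj v u && exposed u x.
Proof.
move=> g1 vx; rewrite {1}/exposed stk_push // top_push /=.
case: ifP => vu //=; last by rewrite orbF; case: eqP.
by case: eqP => // uv; rewrite uv adj_irr in vu.
Qed.

Lemma split_off v x : exists g y, x = gp_in adj v g * y /\ ~~ exposed v y.
Proof.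
have [sy sv _] := rep_split v (rep_stk x).
exists (head_at v (stk x)), ((gp_in adj v (head_at v (stk x)))^-1 * x).
rewrite mulVKg; split=> //; apply/exposedPn.
by rewrite -gp_inV stk_in; move: sv; rewrite /act mulVg /push_at eqxx.
Qed.

Lemma exposed_split v x : exposed v x ->
  exists g y, [/\ g <> 1, ~~ exposed v y & x = gp_in adj v g * y].
Proof.
move=> vx; have [g [y [xE vy]]] := split_off v x; exists g, y; split=> // g1.
by move: vx; rewrite xE g1 gp_in1 mul1g (negbTE vy).
Qed.

(** All reduced expressions of an element produce the same piling. *)
Lemma rep_stkE s x : rep s x -> s = stk x.
Proof.
elim=> [|[v g] {}s {}x sx IH sv g1]; first by rewrite stk1.
by rewrite -[gp_letter _]/(gp_in adj v g) stk_push -?IH //; apply/exposedPn; rewrite -IH.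
Qed.

(** Induction along a reduced expression. *)
Lemma gprod_ind (P : gprod -> Prop) : P 1 ->
  (forall v (g : G v) x, g <> 1 -> ~~ exposed v x -> P x -> P (gp_in adj v g * x)) ->
  forall x, P x.
Proof.
move=> P1 PS x; elim: (rep_stk x) => // -[v g] s y sy Py sv g1; apply: PS => //.
by apply/exposedPn; rewrite -(rep_stkE sy).
Qed.

Lemma exposed1 v : exposed v 1 = false.
Proof. by rewrite /exposed stk1. Qed.

Lemma exposed_exists x : x <> 1 -> exists v, exposed v x.
Proof.
move=> x1; apply: contrapT => nH; apply: x1; apply: (rep_top_None (rep_stk x)) => v.
by apply/exposedPn/negP => vx; apply: nH; exists v.
Qed.

Definition supp v x : bool := has isSome (stk x v).

Lemma supp1 v : supp v 1 = false. Proof. by rewrite /supp stk1. Qed.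

Lemma supp_push v (g : G v) x u : g <> 1 -> ~~ exposed v x ->
  supp u (gp_in adj v g * x) = (u == v) || supp u x.
Proof.
move=> g1 vx; rewrite /supp stk_push // /push /=.
case: ifP => [vu|_] /=; last by case: eqP.
by case: eqP => // uv; rewrite uv adj_irr in vu.
Qed.

Lemma exposed_supp v x : exposed v x -> supp v x.
Proof. by rewrite /exposed /supp /top; case: (stk x v) => [|[l|] t]. Qed.

(** A sufficient condition for the concatenation of reduced expressions of [x]
    and [y] to be reduced. *)
Definition independent x y := forall w, supp w x -> ~~ exposed w y.

(** Pushing the syllables of [x] on top of the piling of [y] never meets a
    syllable of the same vertex: within [x] by reducedness, and at the bottom of
    [x] by independence. *)
Lemma stk_mul x y : independent x y -> stk (x * y) = fun u => stk x u ++ stk y u.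
Proof.
elim/gprod_ind: x y => [|v g x g1 vx IH] y xy; first by rewrite mul1g stk1.
have {}IH := IH y _; rewrite -mulgA [LHS]stk_push //.
  rewrite IH; last by move=> w wx; apply: xy; rewrite supp_push // wx orbT.
  by apply/funext => u; rewrite stk_push // /push; case: ifP.
apply/exposedPn; rewrite /top IH; last first.
  by move=> w wx; apply: xy; rewrite supp_push // wx orbT.
have vy : ~~ exposed v y by apply: xy; rewrite supp_push // eqxx.
move/exposedPn: vx; move/exposedPn: vy; rewrite /top.
by case: (stk x v).
Qed.

Lemma exposed_mul x y u : independent x y ->
  exposed u (x * y) = if stk x u is [::] then exposed u y else exposed u x.
Proof. by move=> xy; rewrite /exposed /top stk_mul //; case: (stk x u). Qed.

Lemma supp_mul x y u : independent x y -> supp u (x * y) = supp u x || supp u y.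
Proof. by move=> xy; rewrite /supp stk_mul // has_cat. Qed.

(** The subgroup generated by the vertex groups of the vertices in [B]. *)
Definition special (B : pred V) : set gprod := [set x | forall v, supp v x -> B v].

Lemma special1 B : special B 1.
Proof. by move=> v; rewrite supp1. Qed.

Lemma special_in B v (g : G v) x : B v -> special B x -> special B (gp_in adj v g * x).
Proof.
move=> Bv; have [h [y [-> vy]]] := split_off v x => Bx.
have By : special B y.
  have [h1|h1] := eqVneq h 1; first by move: Bx; rewrite h1 gp_in1 mul1g.
  move=> u uy; apply: Bx; rewrite supp_push ?uy ?orbT //; exact/eqP.
rewrite mulgA -gp_inM; have [->|gh1] := eqVneq (g * h) 1; first by rewrite gp_in1 mul1g.
by move=> u; rewrite supp_push //; [case: eqP => [->|_ /By]|exact/eqP].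
Qed.

Lemma special_ind B (P : gprod -> Prop) : P 1 ->
  (forall v (g : G v) x, g <> 1 -> ~~ exposed v x -> B v -> special B x ->
    P x -> P (gp_in adj v g * x)) ->
  forall x, special B x -> P x.
Proof.
move=> P1 PS; elim/gprod_ind => [//|v g x g1 vx IH] Bx.
have Bv : B v by apply: Bx; rewrite supp_push // eqxx.
have {}Bx : special B x by move=> u ux; apply: Bx; rewrite supp_push // ux orbT.
exact: PS (IH Bx).
Qed.

Lemma specialM B x y : special B x -> special B y -> special B (x * y).
Proof.
move=> Bx By; elim/special_ind: Bx => [|v g {}x g1 vx Bv _ IH]; first by rewrite mul1g.
by rewrite -mulgA; apply: special_in.
Qed.

Lemma special_gp_in B v (g : G v) : B v -> special B (gp_in adj v g).
Proof.
by move=> Bv; rewrite -[gp_in _ _ _]mulg1; apply: special_in (@special1 B).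
Qed.

Lemma specialV B x : special B x -> special B x^-1.
Proof.
elim/special_ind => [|v g {}x g1 vx Bv _ IH]; first by rewrite invg1; apply: special1.
by rewrite invgM; apply: specialM => //; rewrite -gp_inV; apply: special_gp_in.
Qed.

(** * Word length in graph products *)

Variable (S : forall v, set (G v)).
Arguments S : clear implicits.
Hypotheses (S_finite : forall v, finite_set (S v)) (S_gen : forall v, generates (S v)).
Local Notation vlen := (wlen (@S_gen _)).
Local Notation SG := (standard_generators adj S).

Lemma gp_in_inj v (g h : G v) : gp_in adj v g = gp_in adj v h -> g = h.
Proof.
move=> E; have : gp_in adj v (g * h^-1) = 1 by rewrite gp_inM E -gp_inM mulgV gp_in1.
have [gh _|gh gh1] := eqVneq (g * h^-1) 1; first by apply: (mulIg h^-1); rewrite gh mulgV.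
have : exposed v (gp_in adj v (g * h^-1) * 1).
  by rewrite exposed_push ?exposed1 ?eqxx //; apply/eqP.
by rewrite mulg1 gh1 exposed1.
Qed.

Definition letter_len (o : option letter) : nat :=
  if o is Some l then vlen (tagged l) else 0%N.
Definition weight x : nat := \sum_(u : V) \sum_(o <- stk x u) letter_len o.

Lemma weight1 : weight 1 = 0%N.
Proof. by rewrite /weight big1 // => u _; rewrite stk1 big_nil. Qed.

Lemma weight_in v (g : G v) x : ~~ exposed v x ->
  weight (gp_in adj v g * x) = (vlen g + weight x)%N.
Proof.
have [-> _|/eqP g1 vx] := eqVneq g 1; first by rewrite gp_in1 mul1g wlen1.
rewrite /weight (bigD1 v) //= [in RHS](bigD1 v) //= addnA; congr (_ + _)%N.
  by rewrite stk_push // /push /= adj_irr eqxx big_cons.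
apply: eq_bigr => u uv; rewrite stk_push // /push /=.
by case: ifP => // _; rewrite (negbTE uv) big_cons.
Qed.

Lemma weight_in_le v (g : G v) x : (weight (gp_in adj v g * x)%g <= vlen g + weight x)%N.
Proof.
have [h [y [-> vy]]] := split_off v x.
by rewrite mulgA -gp_inM !weight_in // addnA leq_add2r wlenM.
Qed.

Lemma weight_mul x y : independent x y -> weight (x * y) = (weight x + weight y)%N.
Proof.
move=> xy; rewrite /weight -big_split; apply: eq_bigr => u _ /=.
by rewrite stk_mul // big_cat.
Qed.

Lemma gp_in_word v (g : G v) n : has_word (S v) g n -> has_word SG (gp_in adj v g) n.
Proof.
elim: n g => [|n IH] g.
  by move=> [[|s a] [_ //= _ <-]]; rewrite big_nil gp_in1; apply: has_word1.
move=> /has_word_cons[s [h [Ss hn ->]]]; rewrite gp_inM -add1n.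
apply: has_wordM (IH h hn); apply: has_word_gen.
case: Ss => Ss; [left|right]; exists v => //.
by exists s^-1 => //; rewrite gp_inV.
Qed.

(** Expanding each syllable of a reduced expression into a geodesic word gives a
    word whose length is the weight; [weight_le_word] is the converse bound,
    since a generator changes the weight by at most one. *)
Lemma weight_word x : has_word SG x (weight x).
Proof.
elim/gprod_ind: x => [|v g x g1 vx IH]; first by rewrite weight1; apply: has_word1.
by rewrite weight_in //; apply: has_wordM IH; apply: gp_in_word; apply: wlenP.
Qed.

Lemma weight_le_word x n : has_word SG x n -> (weight x <= n)%N.
Proof.
elim: n x => [|n IH] x.
  by move=> [[|s a] [_ //= _ <-]]; rewrite big_nil weight1.
move=> /has_word_cons[s [y [Ss yn ->]]].
have [v [t tS ->]] : exists v, exists2 t : G v, S v t \/ S v t^-1 & s = gp_in adj v t.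
  case: Ss => -[v _ [t St tE]]; exists v; first by exists t => //; left.
  by exists t^-1; [right; rewrite invgK|rewrite gp_inV tE invgK].
apply: (leq_trans (weight_in_le _ _)); rewrite -add1n leq_add ?IH //.
by apply: wlen_min; apply: has_word_gen.
Qed.

Lemma standard_generates : generates SG.
Proof. by move=> x; exists (weight x); apply: weight_word. Qed.

Local Notation len := (wlen standard_generates).

Lemma lenE x : len x = weight x.
Proof.
by apply/anti_leq; rewrite wlen_min ?weight_le_word //; [apply: wlenP|apply: weight_word].
Qed.

Lemma standard_finite : finite_set SG.
Proof.
apply: bigcup_finite => // v _; exact: finite_image.
Qed.

Lemma len_in v (g : G v) x : ~~ exposed v x ->
  len (gp_in adj v g * x) = (vlen g + len x)%N.
Proof. by rewrite !lenE; apply: weight_in. Qed.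

Lemma len_gp_in v (g : G v) : len (gp_in adj v g) = vlen g.
Proof. by rewrite -[gp_in _ _ _]mulg1 len_in ?exposed1 // wlen1 addn0. Qed.

Lemma len_mul x y : independent x y -> len (x * y) = (len x + len y)%N.
Proof. by rewrite !lenE; apply: weight_mul. Qed.

Local Notation cnt := (cnt SG).

(** A geodesic word of an element of a special subgroup uses only generators of
    that subgroup, so it can be cut at any place; this is what makes the growth
    of special subgroups submultiplicative. *)
Lemma special_split B x m n : special B x -> len x = (m + n)%N ->
  exists y z, [/\ special B y, special B z, len y = m, len z = n & x = y * z].
Proof.
move=> Bx; elim: m x Bx => [|m IH] x Bx xmn.
  by exists 1, x; rewrite wlen1 mul1g; split=> //; apply: special1.
have [s [x' [Bs Bx' s1 x'mn xE]]] : exists s x',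
    [/\ special B s, special B x', len s = 1%N, len x' = (m + n)%N & x = s * x'].
  move: xmn; elim/special_ind: Bx {IH} => [|v g {}x g1 vx Bv Bx _].
    by rewrite wlen1.
  rewrite len_in //; case E : (vlen g) => [|k]; first by case: g1; apply: wlen_eq0 E.
  have [s [h [s1 hk gE]]] := wlen_split E => xmn.
  exists (gp_in adj v s), (gp_in adj v h * x); split.
  - exact: special_gp_in.
  - exact: special_in.
  - by rewrite len_gp_in.
  - by rewrite len_in // hk; lia.
  - by rewrite gE gp_inM mulgA.
have [y [z [By Bz ym zn x'E]]] := IH x' Bx' x'mn.
exists (s * y), z; split=> //; first exact: specialM.
  have := wlenM standard_generates s y; have := wlenM standard_generates (s * y) z.
  rewrite -mulgA -x'E -xE xmn s1 ym zn add1n leq_add2r => mle lem.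
  by apply/anti_leq; rewrite mle lem.
by rewrite -mulgA -x'E.
Qed.

Lemma cnt_special_submult B m n :
  (cnt (special B) (m + n) <= cnt (special B) m * cnt (special B) n)%N.
Proof.
by refine (cnt_submult standard_finite (gen := standard_generates) _) => z;
  apply: special_split.
Qed.

(** * Decomposition along one vertex *)

Section Vertex.
Variable (v0 : V).

Definition vertex_free : set gprod := special (predC1 v0).
Definition vertex_group : set gprod := special (pred1 v0).
Definition vertex_syllable : set gprod := [set x | vertex_group x /\ x <> 1].
(** The elements that can stand between two consecutive syllables of [v0]: no
    part of them can be shuffled past the syllable on their left. *)
Definition separator : set gprod :=
  [set x | [/\ vertex_free x, x <> 1 & forall w, exposed w x -> ~~ adj v0 w]].
Definition vertex_headed : set gprod := [set x | forall w, exposed w x -> w = v0].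
Definition block : set gprod :=
  [set x | exists s t, [/\ vertex_syllable s, separator t & x = s * t]].
Definition block_headed : set gprod :=
  [set x | exists s t, [/\ block s, vertex_headed t & x = s * t]].

Lemma independent_mull x y u : independent x y -> exposed u x -> exposed u (x * y).
Proof.
by move=> xy ux; rewrite exposed_mul //; move: ux; rewrite /exposed /top; case: (stk x u).
Qed.

(** Two syllables can both be shuffled to the front only if they commute. *)
Lemma exposed_adj x u w : exposed u x -> exposed w x -> u <> w -> adj u w.
Proof.
move=> /exposed_split[g [y [g1 uy ->]]]; rewrite exposed_push //.
by case/orP => [/eqP ->|/andP[]].
Qed.

Lemma vertex_syllableP x : vertex_syllable x -> exists2 g, g <> 1 & x = gp_in adj v0 g.
Proof.
move=> [Vx /exposed_exists[w wx]].
have wv : w = v0 by apply/eqP/Vx/exposed_supp.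
have [g [y [g1 vy xE]]] := exposed_split wx; subst w; exists g => //.
suff y1 : y = 1 by rewrite xE y1 mulg1.
apply: contrapT => /exposed_exists[w wy].
have : w = v0 by apply/eqP/Vx; rewrite xE supp_push // exposed_supp ?orbT.
by move=> wE; rewrite wE (negbTE vy) in wy.
Qed.

Lemma vertex_syllable_in (g : G v0) : g <> 1 -> vertex_syllable (gp_in adj v0 g).
Proof.
move=> g1; split; first by apply: special_gp_in; rewrite /= eqxx.
by rewrite -(gp_in1 v0) => /gp_in_inj.
Qed.

Lemma vertex_free_independent a y : vertex_free a -> vertex_headed y -> independent a y.
Proof. by move=> Aa Qy w /Aa /= wv; apply/negP => /Qy wE; rewrite wE eqxx in wv. Qed.

(** Strip exposed syllables other than those of [v0] from the left as long as
    there are any. *)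
Lemma vertex_free_factor x : exists a y, [/\ vertex_free a, vertex_headed y & x = a * y].
Proof.
have [n] := ubnP (len x); elim: n x => // n IH x xn.
have [Qx|nQ] := pselect (vertex_headed x).
  by exists 1, x; rewrite mul1g; split=> //; apply: special1.
have [w wx wv] : exists2 w, exposed w x & w != v0.
  apply: contrapT => nH; apply: nQ => w wx; apply: contrapT => wv.
  by apply: nH; exists w => //; apply/eqP.
have [g [y [g1 wy xE]]] := exposed_split wx.
have [|a [z [Aa Qz yE]]] := IH y.
  move: xn; rewrite xE len_in //; case E : (vlen g) => [|k] xn; last by lia.
  by case: g1; apply: wlen_eq0 E.
exists (gp_in adj w g * a), z; split=> //; first exact: special_in.
by rewrite xE yE mulgA.
Qed.

(** The quotient of the two first factors contains no syllable of [v0]; were it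
    nontrivial, one of its vertices would be exposed in [y']. *)
Lemma vertex_free_factor_inj a y a' y' : vertex_free a -> vertex_headed y ->
  vertex_free a' -> vertex_headed y' -> a * y = a' * y' -> a = a'.
Proof.
move=> Aa Qy Aa' Qy' E; pose b := a'^-1 * a.
have Ab : vertex_free b by apply: specialM => //; apply: specialV.
have bE : b * y = y' by rewrite -mulgA E mulKg.
suff b1 : b = 1 by apply: (mulgI a'^-1); rewrite mulVg.
apply: contrapT => /exposed_exists[w wb].
have wv : w = v0.
  by apply: Qy'; rewrite -bE; apply: independent_mull => //; apply: vertex_free_independent.
by have := Ab w (exposed_supp wb); rewrite /= wv eqxx.
Qed.

Lemma cnt_setT n : cnt setT n =
  (\sum_(k < n.+1) cnt vertex_free k * cnt vertex_headed (n - k))%N.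
Proof.
apply: (cnt_mul standard_finite (gen := standard_generates)).
- by move=> a y Aa Qy; split=> //; apply/len_mul/vertex_free_independent.
- by move=> x _; apply: vertex_free_factor.
- exact: vertex_free_factor_inj.
Qed.

(** The stack of [v0] in a separator is nonempty and holds only blanks, so it
    hides the syllables of [v0] in [y]. *)
Lemma separator_exposed t y w : separator t -> vertex_headed y ->
  exposed w (t * y) -> w <> v0 /\ ~~ adj v0 w.
Proof.
move=> [At t1 Tt] Qy.
rewrite exposed_mul; last exact: vertex_free_independent.
case tw: (stk t w) => [|o q] wE; last first.
  split; last exact: Tt.
  by have := At w (exposed_supp wE) => /= /eqP.
have wv := Qy w wE; subst w.
have [u ut] := exposed_exists t1.
have [g [t' [g1 ut' tE]]] := exposed_split ut.
move: tw; rewrite tE stk_push // /push /= adj_sym.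
by rewrite (negbTE (Tt u ut)).
Qed.

Lemma syllable_independent s z : vertex_syllable s -> ~~ exposed v0 z -> independent s z.
Proof. by move=> [Vs _] vz w /Vs /= /eqP ->. Qed.

Lemma vertex_headed1 : vertex_headed 1.
Proof. by move=> w; rewrite exposed1. Qed.

Lemma syllable_separator_mul s t y : vertex_syllable s -> separator t -> vertex_headed y ->
  vertex_headed (s * (t * y)) /\ len (s * (t * y)) = (len s + (len t + len y))%N.
Proof.
move=> Xs Tt Qy.
have vty : ~~ exposed v0 (t * y) by apply/negP => /(separator_exposed Tt Qy)[].
split; last first.
  rewrite len_mul; last exact: syllable_independent.
  by rewrite (@len_mul t) //; apply: vertex_free_independent => //; case: Tt.
have [g g1 ->] := vertex_syllableP Xs.
move=> w; rewrite exposed_push // => /orP[/eqP //|/andP[vw /(separator_exposed Tt Qy)[_]]].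
by rewrite vw.
Qed.

Lemma syllable_separator_inj s t y s' t' y' :
  vertex_syllable s -> separator t -> vertex_headed y ->
  vertex_syllable s' -> separator t' -> vertex_headed y' ->
  s * (t * y) = s' * (t' * y') -> s = s' /\ t = t'.
Proof.
move=> Xs Tt Qy Xs' Tt' Qy' E; have ss' : s = s'.
  pose r := s'^-1 * s.
  have rE : r * (t * y) = t' * y' by rewrite -mulgA E mulKg.
  suff r1 : r = 1 by apply: (mulgI s'^-1); rewrite mulVg.
  apply: contrapT => r1.
  have Xr : vertex_syllable r.
    by split=> //; apply: specialM; [apply: specialV; case: Xs'|case: Xs].
  have [g g1 rg] := vertex_syllableP Xr.
  have vty : ~~ exposed v0 (t * y) by apply/negP => /(separator_exposed Tt Qy)[].
  have : exposed v0 (t' * y') by rewrite -rE rg exposed_push // eqxx.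
  by move=> /(separator_exposed Tt' Qy')[].
split=> //; subst s'; move/mulgI: E; apply: vertex_free_factor_inj => //;
  [by case: Tt|by case: Tt'].
Qed.

Lemma cnt_block n : cnt block n =
  (\sum_(k < n.+1) cnt vertex_syllable k * cnt separator (n - k))%N.
Proof.
apply: (cnt_mul standard_finite (gen := standard_generates)).
- move=> s t Xs Tt; split; first by exists s, t.
  by have [_] := syllable_separator_mul Xs Tt vertex_headed1; rewrite mulg1 wlen1 addn0.
- by move=> _ [s [t [Xs Tt ->]]]; exists s, t.
- move=> s t s' t' Xs Tt Xs' Tt' E.
  have [] := @syllable_separator_inj s t 1 s' t' 1 Xs Tt vertex_headed1 Xs' Tt'
    vertex_headed1; by rewrite ?mulg1.
Qed.

Lemma cnt_block_headed n : cnt block_headed n =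
  (\sum_(k < n.+1) cnt block k * cnt vertex_headed (n - k))%N.
Proof.
apply: (cnt_mul standard_finite (gen := standard_generates)).
- move=> _ y [s [t [Xs Tt ->]]] Qy; split.
    by exists (s * t), y; split=> //; exists s, t.
  have [_] := syllable_separator_mul Xs Tt vertex_headed1; rewrite mulg1 wlen1 addn0 => ->.
  by have [_] := syllable_separator_mul Xs Tt Qy; rewrite mulgA addnA.
- by move=> _ [u [y [Uu Qy ->]]]; exists u, y.
- move=> _ y _ y' [s [t [Xs Tt ->]]] Qy [s' [t' [Xs' Tt' ->]]] Qy'; rewrite -!mulgA => E.
  by have [-> ->] := syllable_separator_inj Xs Tt Qy Xs' Tt' Qy' E.
Qed.

(** Remove the first syllable of [v0], then the longest prefix without syllables
    of [v0]: either nothing is left, or that prefix is a separator, because an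
    exposed neighbour of [v0] in it would be exposed in [x]. *)
Lemma vertex_headed_cover x : vertex_headed x <-> vertex_group x \/ block_headed x.
Proof.
split=> [Qx|]; last first.
  case=> [Vx w /exposed_supp /Vx /eqP //|[_ [y [[s [t [Xs Tt ->]]] Qy ->]]]].
  by rewrite -mulgA; have [] := syllable_separator_mul Xs Tt Qy.
have [->|/eqP /exposed_exists[w wx]] := eqVneq x 1; first by left; apply: special1.
have wv := Qx w wx; subst w; have [g [z [g1 vz xE]]] := exposed_split wx.
have [a [y [Aa Qy zE]]] := vertex_free_factor z.
(* If the prefix is trivial, the remainder can expose only [v0], yet it does not. *)
have [a1|/eqP a1] := eqVneq a 1.
  left; suff z1 : z = 1 by rewrite xE z1 mulg1; apply: special_gp_in; rewrite /= eqxx.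
  apply: contrapT => /exposed_exists[w wz].
  have wv : w = v0 by apply: Qy; rewrite -[y]mul1g -a1 -zE.
  by rewrite wv (negbTE vz) in wz.
right; exists (gp_in adj v0 g * a), y; split=> //; last by rewrite xE zE mulgA.
exists (gp_in adj v0 g), a; split=> //; first exact: vertex_syllable_in.
split=> // w wa; apply/negP => vw.
have wz : exposed w z by
  by rewrite zE; apply: independent_mull => //; apply: vertex_free_independent.
have wE : w = v0 by apply: Qx; rewrite xE exposed_push // vw wz orbT.
by rewrite wE adj_irr in vw.
Qed.

Lemma vertex_group_not_block_headed x : vertex_group x -> block_headed x -> False.
Proof.
move=> Vx [_ [y [[s [t [Xs Tt ->]]] Qy xE]]].
have [At t1 _] := Tt; have [w wt] := exposed_exists t1.
have vty : ~~ exposed v0 (t * y) by apply/negP => /(separator_exposed Tt Qy)[].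
have wx : supp w x.
  rewrite xE -mulgA supp_mul; last exact: syllable_independent.
  by rewrite supp_mul ?(exposed_supp wt) ?orbT //; apply: vertex_free_independent.
have := At w (exposed_supp wt); have := Vx w wx => /= /eqP ->.
by rewrite eqxx.
Qed.

Lemma cnt_vertex_headed n :
  cnt vertex_headed n = (cnt vertex_group n + cnt block_headed n)%N.
Proof.
rewrite -(cntU standard_finite standard_generates); last exact: vertex_group_not_block_headed.
by apply: (eq_cnt standard_finite (gen := standard_generates)) => x _;
  apply: vertex_headed_cover.
Qed.

Lemma cnt_vertex_groupS n : cnt vertex_group n.+1 = cnt vertex_syllable n.+1.
Proof.
apply: (eq_cnt standard_finite (gen := standard_generates)) => x xn; split=> [Vx|[]//].
by split=> // x1; rewrite x1 wlen1 in xn.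
Qed.

Lemma cnt_eq0 (Y : set gprod) : ~ Y 1 -> cnt Y 0 = 0%N.
Proof.
move=> Y1; apply/eqP; rewrite cardfs_eq0; apply/eqP/fsetP => x.
rewrite (in_slice standard_finite standard_generates) inE.
by apply/negbTE/negP => /asboolP[Yx /wlen_eq0 xE]; apply: Y1; rewrite -xE.
Qed.

(** * Every element is boundedly close to a separator *)

Section Reach.
Variable letter1 : forall v, G v.
Hypothesis letter1_len : forall v, vlen (letter1 v) = 1%N.

Lemma letter1_neq1 v : letter1 v <> 1.
Proof. by move=> E; have := letter1_len v; rewrite E wlen1. Qed.

Definition lword (a : seq V) : gprod := \prod_(v <- a) gp_in adj v (letter1 v).

(** Multiplying on the left by generators along a path of the opposite graph
    starting at the exposed vertex [u]: each new generator commutes with neither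
    its predecessor nor, at the first step, the syllable of [u], so no
    cancellation occurs, each of them hides the previous one, and only the last
    one becomes exposed. *)
Lemma path_reach p u x : exposed u x -> path (opposite adj) u p ->
  v0 \notin p -> vertex_free x ->
  exists a, [/\ size a = size p, vertex_free (lword a * x),
    len (lword a * x) = (size p + len x)%N &
    forall w, exposed w (lword a * x) -> w = last u p \/ exposed w x /\ w <> u].
Proof.
elim: p u x => [|q p IH] u x ux /=.
  move=> _ _ Ax; exists [::]; rewrite /lword big_nil mul1g; split=> // w wx.
  by have [->|/eqP] := eqVneq w u; [left|right].
rewrite inE negb_or => /andP[/andP[uq /negbTE nuq] qp] /andP[vq vp] Ax.
have qx : ~~ exposed q x.
  by apply/negP => /(exposed_adj ux); rewrite nuq => /(_ (elimN eqP uq)).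
have q1 := @letter1_neq1 q.
have ux1 : exposed q (gp_in adj q (letter1 q) * x) by rewrite exposed_push // eqxx.
have [|a [pa Aa la wa]] := IH q _ ux1 qp vp.
  by apply: special_in => //; rewrite /= eq_sym.
have E : lword (a ++ [:: q]) * x = lword a * (gp_in adj q (letter1 q) * x).
  by rewrite /lword big_cat big_seq1 mulgA.
exists (a ++ [:: q]); rewrite E; split=> //.
- by rewrite size_cat pa addn1.
- by rewrite la len_in // letter1_len addnA addn1.
- move=> w /wa[->|[]]; first by left.
  rewrite exposed_push // => + wq; case/orP => [/eqP //|/andP[qw wx]].
  by right; split=> // wu; rewrite wu adj_sym nuq in qw.
Qed.

Hypothesis anticon : anticonnected adj.

(** Each round hides one exposed neighbour [u] of [v0] behind a path of the
    opposite graph from [u] that stops just before [v0].  The last vertex of the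
    path is not a neighbour of [v0], so the number of exposed neighbours drops. *)
Lemma reach_separator x (k : nat) : vertex_free x -> x <> 1 ->
  (#|[pred w | exposed w x && adj v0 w]| <= k)%N ->
  exists a, [/\ (size a <= k * #|V|)%N, separator (lword a * x) &
    len (lword a * x) = (size a + len x)%N].
Proof.
elim: k x => [|k IH] x Ax x1 xk.
  exists [::]; rewrite /lword big_nil mul1g; split=> //; split=> // w wx.
  move: xk; rewrite leqn0 => /eqP/card0_eq/(_ w).
  by rewrite !inE wx /= => ->.
have [[u ux vu]|nH] := pselect (exists2 u, exposed u x & adj v0 u); last first.
  exists [::]; rewrite /lword big_nil mul1g; split=> //; split=> // w wx.
  by apply/negP => vw; apply: nH; exists w.
have /connectP[p0 /shortenP[p up]] := anticon u v0; rewrite cons_uniq => /andP[+ pU] _.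
case/lastP: p up pU => [|p z] up pU; first by move=> _ /= uv; rewrite uv adj_irr in vu.
rewrite last_rcons => _ zv; subst z.
move: up pU; rewrite rcons_path rcons_uniq => /andP[up /andP[_ lv]] /andP[vp pU].
have [a [pa Aa la wa]] := path_reach ux up vp Ax.
have [||b [bk Tb lb]] := IH (lword a * x) Aa.
- move=> a1; move: la; rewrite a1 wlen1 => /esym/eqP.
  by rewrite addn_eq0 => /andP[_ /eqP /wlen_eq0].
- rewrite -ltnS; apply: leq_trans xk; apply: proper_card; apply/properP; split.
    apply/fintype.subsetP => w; rewrite !inE => /andP[/wa[wl|[wx _]] vw];
      last by rewrite wx.
    by rewrite wl adj_sym (negbTE lv) in vw.
  exists u; rewrite !inE ?ux // vu andbT; apply/negP => /wa[ul|[_ //]].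
  by rewrite -ul adj_sym vu in lv.
have E : lword (b ++ a) * x = lword b * (lword a * x) by rewrite /lword big_cat mulgA.
exists (b ++ a); rewrite E size_cat; split=> //; last by rewrite lb la pa addnA.
rewrite mulSn addnC leq_add // pa.
by rewrite -(card_uniqP pU) max_card.
Qed.

(** Hence the elements without syllables of [v0] grow no faster than separators:
    there are at most #|V| rounds of at most #|V| letters each. *)
Lemma cnt_vertex_free_le n :
  (cnt vertex_free n.+1 <=
    #|V| ^ (#|V| * #|V|) * \sum_(j < (#|V| * #|V|).+1) cnt separator (n.+1 + j))%N.
Proof.
pose Y j : set gprod := [set x | exists a : j.-tuple V,
  separator (lword a * x) /\ len (lword a * x) = (j + len x)%N].
have V0 : (0 < #|V|)%N by apply/card_gt0P; exists v0.
apply: (@leq_trans (\sum_(j < (#|V| * #|V|).+1) cnt (Y j) n.+1)).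
  refine (cnt_union standard_finite (gen := standard_generates) _) => x Ax xn.
  have x1 : x <> 1 by move=> xE; rewrite xE wlen1 in xn.
  have [a [am Ta la]] := reach_separator Ax x1 (max_card _).
  by exists (size a) => //; exists (in_tuple a).
rewrite big_distrr; apply: leq_sum => j _ /=.
apply: (@leq_trans (#|V| ^ j * cnt separator (n.+1 + j))).
  rewrite -card_tuple.
  refine (cnt_cover standard_finite (gen := standard_generates)
    (h := fun a : j.-tuple V => lword a) _).
  by move=> x [a [Ta la]] xn; exists a; rewrite la xn addnC.
by rewrite leq_mul2r leq_pexp2l ?orbT // -ltnS.
Qed.

Lemma cnt_vertex_syllable1 : (0 < cnt vertex_syllable 1)%N.
Proof.
have := cnt_gt0 standard_finite standard_generates (vertex_syllable_in (@letter1_neq1 v0)).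
by rewrite len_gp_in letter1_len.
Qed.

Lemma exposed_gp_in v (g : G v) u : g <> 1 -> exposed u (gp_in adj v g) = (u == v).
Proof. by move=> g1; rewrite -[gp_in _ _ _]mulg1 exposed_push ?exposed1 // andbF orbF. Qed.

Lemma cnt_separator1 w : w != v0 -> ~~ adj v0 w -> (0 < cnt separator 1)%N.
Proof.
move=> wv vw; have w1 := @letter1_neq1 w.
have Tw : separator (gp_in adj w (letter1 w)).
  split; [exact: special_gp_in|by rewrite -(gp_in1 w) => /gp_in_inj|].
  by move=> u; rewrite exposed_gp_in // => /eqP ->.
by have := cnt_gt0 standard_finite standard_generates Tw; rewrite len_gp_in letter1_len.
Qed.

Lemma cnt_separator2 w u : w != v0 -> ~~ adj v0 w -> u != v0 -> u != w ->
  ~~ adj v0 u \/ ~~ adj w u -> (0 < cnt separator 2)%N.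
Proof.
move=> wv vw uv uw H; have w1 := @letter1_neq1 w; have u1 := @letter1_neq1 u.
pose x := gp_in adj w (letter1 w) * gp_in adj u (letter1 u).
have wu : ~~ exposed w (gp_in adj u (letter1 u)) by rewrite exposed_gp_in // eq_sym.
have Tx : separator x.
  split.
  - by apply: special_in => //; apply: special_gp_in.
  - by move=> x1; have := exposed1 w; rewrite -x1 exposed_push // eqxx.
  - move=> z; rewrite exposed_push // exposed_gp_in //.
    move=> /orP[/eqP -> //|/andP[wz /eqP zE]].
    by subst z; case: H => //; rewrite wz.
have := cnt_gt0 standard_finite standard_generates Tx.
by rewrite /x len_in // len_gp_in !letter1_len.
Qed.

End Reach.
End Vertex.
End Pilings.

(** * Aperiodicity from the opposite graph *)

Lemma connected_exit (V : finType) (e : rel V) (a : pred V) x y :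
  connected_graph e -> a x -> ~~ a y -> exists u w, [/\ a u, ~~ a w & e u w].
Proof.
move=> /(_ x y)/connectP[p + ->]; elim: p x => [|z p IH] x /=; first by move=> _ ->.
move=> /andP[xz zp] ax; have [az|az] := boolP (a z); first exact: IH.
by exists x, z.
Qed.

(** The vertices [w] and [u] provide separators of lengths 1 and 2, so that blocks
    have lengths 2 and 3: in a connected graph an edge leaves [v], and another
    one leaves the pair [v], [w]. *)
Lemma anticonnected_neighbours (V : finType) (adj : rel V) (v : V) :
  anticonnected adj -> (3 <= #|V|)%N -> exists w u,
    [/\ w != v, ~~ adj v w, u != v, u != w & ~~ adj v u \/ ~~ adj w u].
Proof.
move=> con V3.
have outside (s : seq V) : (size s <= 2)%N -> exists y, y \notin s.
  move=> s2; apply: contrapT => nH; have : (#|V| <= size s)%N.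
    rewrite cardE; apply: uniq_leq_size (enum_uniq _) _ => y _.
    by apply: contrapT => ys; apply: nH; exists y; apply/negP.
  by lia.
have [y] := outside [:: v] isT; rewrite inE => yv.
have [v' [w [/eqP -> wv /andP[_ vw]]]] := connected_exit con (eqxx v : pred1 v v) yv.
have [z] := outside [:: v; w] isT; rewrite !inE => zvw.
have [x [u [xvw uvw /andP[_ xu]]]] :=
  connected_exit con (predU1l _ (erefl v) : pred2 v w v) zvw.
move: uvw; rewrite /= negb_or => /andP[uv uw].
exists w, u; split=> //.
by case/orP: xvw => /eqP xE; rewrite xE in xu; [left|right].
Qed.

Local Open Scope ring_scope.

(** * The renewal theorem *)

Section Renewal.
Variable R : realType.
Implicit Types (a b d p q w : nat -> R).

Definition psum a n : R := \sum_(k < n) a k.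
Definition cauchy_prod a b n : R := \sum_(k < n.+1) a k * b (n - k)%N.
(** The probability of exceeding [k], for a distribution [p] of total mass 1.
    Its sum over all [k] is the mean of [p]. *)
Definition tail p k : R := 1 - psum p k.+1.

Lemma psumS a n : psum a n.+1 = psum a n + a n.
Proof. by rewrite /psum big_ord_recr. Qed.

Lemma psum_nondecreasing a : (forall n, 0 <= a n) ->
  {homo psum a : m n / (m <= n)%N >-> m <= n}.
Proof.
move=> a0; apply: homo_leq => // [x y z|n]; first exact: le_trans.
by rewrite psumS lerDl.
Qed.

Lemma psum_ge0 a n : (forall n, 0 <= a n) -> 0 <= psum a n.
Proof. by move=> a0; apply: sumr_ge0 => k _. Qed.

Lemma ler_psum a b n : (forall k, a k <= b k) -> psum a n <= psum b n.
Proof. by move=> ab; apply: ler_sum. Qed.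

Lemma psumD a m n : psum a (m + n) = psum a m + psum (fun k => a (m + k)%N) n.
Proof. by rewrite /psum big_split_ord. Qed.

Lemma psum_term_le a k n : (forall n, 0 <= a n) -> (k < n)%N -> a k <= psum a n.
Proof.
move=> a0 kn; apply: le_trans (psum_nondecreasing a0 kn).
by rewrite psumS lerDr psum_ge0.
Qed.

Lemma psum_cvg a M : (forall n, 0 <= a n) -> (forall n, psum a n <= M) ->
  cvgn (psum a).
Proof.
move=> a0 aM; apply: nondecreasing_is_cvgn; first exact: psum_nondecreasing.
by exists M => _ [n _ <-].
Qed.

Lemma psum_le_lim a n : (forall n, 0 <= a n) -> cvgn (psum a) ->
  psum a n <= limn (psum a).
Proof.
by move=> a0 /nondecreasing_cvgn_le; apply; apply: psum_nondecreasing.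
Qed.

Lemma psum_block_le a l K n : (forall n, 0 <= a n) ->
  (forall n, psum a n <= l) ->
  \sum_(k < n | (K < k)%N) a k <= l - psum a K.+1.
Proof.
move=> a0 al; rewrite lerBrDr; apply: le_trans (al (maxn n K.+1)).
have -> : \sum_(k < n | (K < k)%N) a k =
    \sum_(k < n) (if (K < k)%N then a k else 0) by rewrite big_mkcond.
have -> : psum a K.+1 = \sum_(k < maxn n K.+1) (if (k <= K)%N then a k else 0).
  rewrite -big_mkcond /psum (big_ord_widen _ _ (leq_maxr n K.+1)).
  by apply: eq_bigl => k; rewrite ltnS.
apply: (@le_trans _ _ (\sum_(k < maxn n K.+1) (if (K < k)%N then a k else 0)
   + \sum_(k < maxn n K.+1) (if (k <= K)%N then a k else 0))).
  rewrite lerD2r (big_ord_widen _ (fun k => if (K < k)%N then a k else 0)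
    (leq_maxl n K.+1)) big_mkcond.
  by apply: ler_sum => k _; case: ifP => // _; case: ifP.
rewrite -big_split; apply: ler_sum => k _ /=.
by case: ltnP => _; rewrite ?addr0 ?add0r.
Qed.

Lemma small_tail a : (forall n, 0 <= a n) -> cvgn (psum a) ->
  forall e, 0 < e -> exists K, forall n, \sum_(k < n | (K < k)%N) a k <= e.
Proof.
move=> a0 ca e e0.
have [K _ HK] := (cvgrPdist_le _ _).1 ca _ e0.
exists K => n.
have := HK K.+1 (leqnSn K); rewrite ger0_norm ?subr_ge0 ?psum_le_lim//.
by apply: le_trans; apply: psum_block_le => // m; apply: psum_le_lim.
Qed.

(** In the Cauchy product, the terms of index at most [K] see only values of [d]
    which are at least [- e], and the others have small total weight. *)
Lemma cauchy_prod_ge w d W C e K m :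
  (forall n, 0 <= w n) -> 0 <= C -> 0 <= e ->
  (forall n, psum w n <= W) ->
  (forall n, \sum_(k < n | (K < k)%N) w k <= e) ->
  (forall n, - C <= d n) ->
  (forall k, (k <= K)%N -> (k <= m)%N -> - e <= d (m - k)%N) ->
  - ((W + C) * e) <= cauchy_prod w d m.
Proof.
move=> w0 C0 e0 wW we dC de.
apply: (@le_trans _ _ (\sum_(k < m.+1) (w k * - e +
   (if (K < k)%N then w k * - C else 0)))); last first.
  apply: ler_sum => k _; case: ltnP => kK.
    have := dC (m - k)%N; have := w0 k; nra.
  have km : (k <= m)%N by rewrite -ltnS.
  by have := de k kK km; have := w0 k; nra.
rewrite big_split -big_mkcond /= -!mulr_suml.
have := wW m.+1; have := we m.+1; rewrite /psum.
set x := \sum_(_ < _) _; set y := \sum_(_ < _ | _) _; nra.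
Qed.

Lemma cauchy_prod_linearB w d c n : cauchy_prod w (fun k => d k - c) n =
  cauchy_prod w d n - c * psum w n.+1.
Proof.
rewrite /cauchy_prod /psum mulr_sumr -sumrB; apply: eq_bigr => k _; ring.
Qed.

Lemma cauchy_prodN w d n : cauchy_prod w (fun k => - d k) n = - cauchy_prod w d n.
Proof. by rewrite /cauchy_prod -sumrN; apply: eq_bigr => k _; rewrite mulrN. Qed.

Lemma cauchy_prod_cvg0_ge w d C : (forall n, 0 <= w n) -> cvgn (psum w) ->
  0 <= C -> (forall n, `|d n| <= C) -> d @ \oo --> 0 ->
  forall e, 0 < e -> \forall n \near \oo, - e <= cauchy_prod w d n.
Proof.
move=> w0 cw C0 dC d0 e e0.
have W0 : 0 <= limn (psum w).
  by apply: le_trans (psum_le_lim 0 w0 cw); rewrite /psum big_ord0.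
pose h := e / (limn (psum w) + C + 1).
have h0 : 0 < h by rewrite /h divr_gt0// ltr_wpDl// addr_ge0.
have [K HK] := small_tail w0 cw h0.
have [N _ HN] := (cvgrPdist_le _ _).1 d0 _ h0.
near=> n.
have nNK : (N + K <= n)%N by near: n; exists (N + K)%N.
have hE : (limn (psum w) + C) * h = e - h.
  by rewrite /h; field; rewrite gt_eqF// ltr_wpDl// addr_ge0.
apply: le_trans (@cauchy_prod_ge w d (limn (psum w)) C h K n w0 C0 (ltW h0) _ HK _ _).
- by rewrite hE; lra.
- by move=> m; apply: psum_le_lim.
- by move=> m; have := dC m; rewrite ler_norml => /andP[].
- move=> k kK kn; have /HN : (N <= n - k)%N by lia.
  by rewrite sub0r normrN ler_norml => /andP[].
Unshelve. all: by end_near. Qed.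

Lemma cauchy_prod_cvg w d l C : (forall n, 0 <= w n) -> cvgn (psum w) ->
  (forall n, `|d n| <= C) -> d @ \oo --> l ->
  cauchy_prod w d @ \oo --> limn (psum w) * l.
Proof.
move=> w0 cw dC dl.
have C0 : 0 <= C by apply: le_trans (dC 0%N).
pose f n := d n - l.
have fC n : `|f n| <= C + `|l| by rewrite (le_trans (ler_normB _ _)) ?lerD2r.
have f0 : f @ \oo --> 0.
  by rewrite -(subrr l); apply: cvgB => //; apply: cvg_cst.
have g0 : (fun n => - f n) @ \oo --> 0 by rewrite -oppr0; apply: cvgN.
have cf : cauchy_prod w f @ \oo --> 0.
  apply/cvgrPdist_le => e e0; near=> n.
  rewrite sub0r normrN ler_norml; apply/andP; split.
    near: n; apply: (@cauchy_prod_cvg0_ge _ _ (C + `|l|)) => //; exact: addr_ge0.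
  rewrite -lerN2 -cauchy_prodN; near: n.
  apply: (@cauchy_prod_cvg0_ge _ _ (C + `|l|)) => //; first exact: addr_ge0.
  by move=> n; rewrite normrN.
have -> : cauchy_prod w d = (fun n => cauchy_prod w f n + psum w n.+1 * l).
  by apply/funext => n; rewrite cauchy_prod_linearB mulrC subrK.
rewrite -[X in _ --> X]add0r; apply: cvgD => //; apply: cvgM; last exact: cvg_cst.
by move/cvg_ex: (cw) => [x wx]; rewrite (cvg_lim _ wx)//; rewrite cvg_shiftS.
Unshelve. all: by end_near. Qed.

Lemma cauchy_prod_recl a b n : cauchy_prod a b n.+1 =
  a 0%N * b n.+1 + \sum_(k < n.+1) a k.+1 * b (n - k)%N.
Proof.
rewrite /cauchy_prod big_ord_recl subn0; congr (_ + _).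
Qed.

Lemma tailS p k : tail p k.+1 = tail p k - p k.+1.
Proof. by rewrite /tail psumS opprD addrA. Qed.

(** The conserved quantity behind the renewal theorem: convolving [q] with the
    tails telescopes. *)
Lemma tail_cauchy p q b : p 0%N = 0 -> (forall n, q n = b n + cauchy_prod p q n) ->
  forall n, cauchy_prod (tail p) q n = psum b n.+1.
Proof.
move=> p0 qE; have t0 : tail p 0 = 1 by rewrite /tail /psum big_ord1 p0 subr0.
elim=> [|n IH].
  rewrite /cauchy_prod big_ord1 t0 mul1r /psum big_ord1 qE /cauchy_prod big_ord1 p0.
  by rewrite mul0r addr0.
rewrite cauchy_prod_recl t0 mul1r psumS -IH qE cauchy_prod_recl p0 mul0r add0r.
rewrite -addrA addrC; congr (_ + _).
rewrite /cauchy_prod -big_split; apply: eq_bigr => k _ /=.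
by rewrite tailS mulrBl addrC subrK.
Qed.

(** The heart of the renewal theorem, for a solution [d] whose upper limit is 0.
    As [d n] is almost an average of earlier values, none of which is
    essentially positive, [d n] can be close to 0 only if [d (n - i)] is, for
    each [i] in the support of [p].  Since 2 and 3 generate all integers from 2
    on, [d] is then close to 0 on arbitrarily long windows. *)
Section Limsup.
Variables (p d b : nat -> R) (C : R).
Hypotheses (p_ge0 : forall n, 0 <= p n) (p_0 : p 0%N = 0).
Hypotheses (p_2 : 0 < p 2) (p_3 : 0 < p 3).
Hypothesis (p_le1 : forall n, psum p n <= 1).
Hypothesis (p_cvg : cvgn (psum p)).
Hypothesis (dE : forall n, d n = b n + cauchy_prod p d n).
Hypothesis (b_cvg : b @ \oo --> 0).
Hypothesis (C_ge0 : 0 <= C).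
Hypothesis (d_bnd : forall n, `|d n| <= C).
Hypothesis (d_sup : forall e, 0 < e -> \forall n \near \oo, d n <= e).

Definition follows i := forall e, 0 < e -> exists2 h, 0 < h &
  \forall n \near \oo, - h <= d n -> - e <= d (n - i)%N.

Lemma follows_step i : 0 < p i -> follows i.
Proof.
move=> pi0 e e0.
pose h := e * p i / (4 + C).
have C4 : 0 < 4 + C by rewrite ltr_wpDr.
have h0 : 0 < h by rewrite /h divr_gt0// mulr_gt0.
have hE : (4 + C) * h = e * p i by rewrite /h; field; rewrite gt_eqF.
exists h => //.
have [K HK] := small_tail p_ge0 p_cvg h0.
have [N _ HN] := d_sup h0.
have [N' _ HN'] := (cvgrPdist_le _ _).1 b_cvg _ h0.
near=> n => dn.
have nN : (N + K + N' + i <= n)%N by near: n; exists (N + K + N' + i)%N.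
(* Separate the term of index [i], and bound the other ones from above. *)
pose w k := if k == i then 0 else p k.
have w0 k : 0 <= w k by rewrite /w; case: ifP.
have wp k : w k <= p k by rewrite /w; case: ifP.
have cwd : cauchy_prod w d n <= (1 + C) * h.
  rewrite -lerN2 -cauchy_prodN; apply: (@cauchy_prod_ge _ _ _ _ _ K) => //;
    first exact: ltW.
  - by move=> m; apply: le_trans (p_le1 m); apply: ler_psum.
  - move=> m; apply: le_trans (HK m); exact: ler_sum.
  - by move=> m; rewrite lerN2; have := d_bnd m; rewrite ler_norml => /andP[].
  - move=> k kK kn; rewrite lerN2; apply: HN => /=; lia.
have pwE : cauchy_prod p d n = cauchy_prod w d n + p i * d (n - i)%N.
  have ni : (i < n.+1)%N by lia.
  rewrite /cauchy_prod (bigD1 (Ordinal ni)) //= [in RHS](bigD1 (Ordinal ni)) //=.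
  rewrite {1}/w eqxx mul0r add0r addrC; congr (_ + _).
  by apply: eq_bigr => k ki; rewrite /w ifN.
have bn : b n <= h.
  have := HN' n; rewrite /= sub0r normrN ler_norml => bn.
  by have /andP[] : - h <= b n <= h by apply: bn; lia.
have := dE n; rewrite pwE => dnE.
rewrite -(ler_pM2l pi0); lra.
Unshelve. all: by end_near. Qed.

Lemma follows_add i j : follows i -> follows j -> follows (i + j).
Proof.
move=> Hi Hj e e0.
have [h h0 Hh] := Hj _ e0; have [h' h'0 Hh'] := Hi _ h0.
exists h' => //; have [N _ {}Hh] := Hh.
near=> n => dn; rewrite subnDA.
apply: Hh => /=; first by have : (N + i <= n)%N; [near: n; exists (N + i)%N|lia].
by move: dn; near: n.
Unshelve. all: by end_near. Qed.

Lemma follows_ge2 i : follows i.+2.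
Proof.
have [i0 i1] : follows i.+2 /\ follows i.+3.
  elim: i => [|i [IH1 IH2]]; first by split; apply: follows_step.
  split=> //; rewrite -(addn2 i.+2); apply: follows_add => //.
  exact: follows_step.
by [].
Qed.

Lemma follows_all K e : 0 < e -> exists2 h, 0 < h & \forall n \near \oo,
  - h <= d n -> forall k, (k <= K)%N -> - e <= d (n - k.+2)%N.
Proof.
move=> e0; elim: K => [|K [h h0 Hh]].
  have [h h0 Hh] := @follows_ge2 0 _ e0; exists h => //.
  near=> n => dn k; rewrite leqn0 => /eqP ->; move: dn; near: n; exact: Hh.
have [h' h'0 Hh'] := @follows_ge2 K.+1 _ e0.
exists (Num.min h h'); first by rewrite lt_min h0.
near=> n => dn k; rewrite leq_eqVlt => /orP[/eqP ->|kK].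
  have: - h' <= d n by apply: le_trans dn; rewrite lerN2 ge_min lexx orbT.
  near: n; exact: Hh'.
have: - h <= d n by apply: le_trans dn; rewrite lerN2 ge_min lexx.
move=> dn'; move: k kK; move: dn'; near: n; exact: Hh.
Unshelve. all: by end_near. Qed.

(** Together with [d_sup], this says that the upper limit of [d] is exactly 0. *)
Hypothesis (d_freq : forall e, 0 < e -> forall N, exists2 n, (N <= n)%N & - e <= d n).

(** A convolution of [d] sees only a long window where [d] is close to 0, up to a
    small error; so its limit cannot be negative. *)
Lemma cauchy_prod_freq_ge w l : (forall n, 0 <= w n) -> cvgn (psum w) ->
  cauchy_prod w d @ \oo --> l -> 0 <= l.
Proof.
move=> w0 cw wl; rewrite leNgt; apply/negP => l0.
have W0 : 0 <= limn (psum w).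
  by apply: le_trans (psum_le_lim 0 w0 cw); rewrite /psum big_ord0.
pose W := limn (psum w).
pose e := - l / 4 / (W + C + 1).
have WC : 0 < W + C + 1 by rewrite ltr_wpDl// addr_ge0.
have e0 : 0 < e by rewrite /e divr_gt0// divr_gt0// oppr_gt0.
have [K HK] := small_tail w0 cw e0.
have [h h0 [N _ HN]] := follows_all K e0.
have l2 : 0 < - l / 2 by lra.
have [N' _ HN'] := (cvgrPdist_le _ _).1 wl _ l2.
have [n nN dn] := d_freq h0 (N + N' + 2)%N.
have nN' : (N' <= n - 2)%N by lia.
have := HN' _ nN'; rewrite ler_norml => /andP[lc _].
have cg : - ((W + C) * e) <= cauchy_prod w d (n - 2)%N.
  apply: (@cauchy_prod_ge _ _ _ _ _ K) => //; first exact: ltW.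
  - by move=> m; apply: psum_le_lim.
  - by move=> m; have := d_bnd m; rewrite ler_norml => /andP[].
  - by move=> k kK _; rewrite -subnDA; apply: HN => //=; lia.
have : (W + C + 1) * e = - l / 4 by rewrite /e; field; rewrite gt_eqF.
nra.
Qed.

End Limsup.

Section RenewalTheorem.
Variables (p : nat -> R) (mu : R).
Hypotheses (p_ge0 : forall n, 0 <= p n) (p_0 : p 0%N = 0).
Hypotheses (p_2 : 0 < p 2) (p_3 : 0 < p 3).
Hypothesis (p_sum : psum p @ \oo --> (1 : R)).
Hypothesis (tail_sum : psum (tail p) @ \oo --> mu).

Let p_le1 n : psum p n <= 1.
Proof.
by rewrite -(cvg_lim _ p_sum) //; apply: psum_le_lim => //; apply: cvgP p_sum.
Qed.

Let tail_ge0 n : 0 <= tail p n. Proof. by rewrite subr_ge0. Qed.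

Let mu_ge1 : 1 <= mu.
Proof.
rewrite -(cvg_lim _ tail_sum) //.
apply: le_trans (psum_le_lim 1 tail_ge0 (cvgP _ tail_sum)).
by rewrite /psum big_ord1 /tail /psum big_ord1 p_0 subr0.
Qed.

(** Subtract the upper limit [L] from [q]; by [tail_cauchy] the convolution of the
    difference with the tails tends to [B - L * mu], so this is nonnegative. *)
Let renewal_le q b (B C : R) : (forall n, q n = b n + cauchy_prod p q n) ->
  psum b @ \oo --> B -> (forall n, `|q n| <= C) ->
  forall e, 0 < e -> \forall n \near \oo, q n <= B / mu + e.
Proof.
move=> qE bB qC.
have C0 : 0 <= C by apply: le_trans (qC 0%N).
pose E := [set M | \forall n \near \oo, q n <= M].
have EC : E C by near=> n; have := qC n; rewrite ler_norml => /andP[].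
have Eb : lbound E (- C).
  move=> M [N _ /(_ N) HN]; apply: le_trans (HN (leqnn N)).
  by have := qC N; rewrite ler_norml => /andP[].
pose L := inf E.
have hE : has_inf E by split; [exists C|exists (- C)].
pose d n := q n - L.
have dE n : d n = (b n - L * tail p n) + cauchy_prod p d n.
  by rewrite cauchy_prod_linearB /d qE /tail; ring.
have b0 : b @ \oo --> 0.
  have -> : b = (fun n => psum b n.+1 - psum b n).
    by apply/funext => n; rewrite psumS addrC addKr.
  by rewrite -(subrr B); apply: cvgB => //; rewrite (cvg_shiftS (psum b)).
have t0 : tail p @ \oo --> 0.
  rewrite -(subrr 1); apply: cvgB; first exact: cvg_cst.
  by rewrite (cvg_shiftS (psum p)).
have b'0 : (fun n => b n - L * tail p n) @ \oo --> 0.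
  rewrite -[X in _ --> X](_ : 0 - L * 0 = 0); last by rewrite mulr0 subrr.
  by apply: cvgB => //; apply: cvgMr.
have dC n : `|d n| <= C + `|L| by rewrite (le_trans (ler_normB _ _)) ?lerD2r.
have dsup e : 0 < e -> \forall n \near \oo, d n <= e.
  move=> e0; have [M EM ML] := inf_adherent e0 hE.
  have [N _ HN] := EM; exists N => // n /HN /= qn.
  by rewrite /d lerBlDr addrC (le_trans qn) // ltW.
have dfreq e : 0 < e -> forall N, exists2 n, (N <= n)%N & - e <= d n.
  move=> e0 N; apply: contrapT => nH.
  have : E (L - e).
    exists N => // n /= Nn; rewrite leNgt; apply/negP => qn; apply: nH.
    by exists n => //; rewrite /d; lra.
  by move/(ge_inf hE.2); rewrite -/L; lra.
have Wd : cauchy_prod (tail p) d @ \oo --> B - L * mu.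
  have -> : cauchy_prod (tail p) d = (fun n => psum b n.+1 - L * psum (tail p) n.+1).
    by apply/funext => n; rewrite cauchy_prod_linearB (tail_cauchy p_0 qE).
  apply: cvgB; first by rewrite (cvg_shiftS (psum b)).
  by apply: cvgMr; rewrite (cvg_shiftS (psum (tail p))).
have LB : 0 <= B - L * mu.
  apply: (cauchy_prod_freq_ge p_ge0 p_2 p_3 p_le1 (cvgP _ p_sum) dE b'0
    (addr_ge0 C0 (normr_ge0 L)) dC dsup dfreq tail_ge0 (cvgP _ tail_sum) Wd).
have LB' : L <= B / mu.
  by rewrite ler_pdivlMr; [rewrite -subr_ge0|apply: lt_le_trans mu_ge1].
move=> e e0; have [N _ HN] := dsup _ e0; exists N => // n /HN; rewrite /d /=.
lra.
Unshelve. all: by end_near. Qed.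

Lemma renewal_theorem q b (B C : R) : (forall n, q n = b n + cauchy_prod p q n) ->
  psum b @ \oo --> B -> (forall n, `|q n| <= C) ->
  q @ \oo --> B / mu.
Proof.
move=> qE bB qC; apply/cvgrPdist_le => e e0.
(* The lower limit of [q] is controlled by the upper limit of [- q]. *)
have qN : forall n, (fun n => - q n) n = - b n + cauchy_prod p (fun n => - q n) n.
  by move=> n /=; rewrite cauchy_prodN qE opprD.
have bN : psum (fun n => - b n) @ \oo --> - B.
  have -> : psum (fun n => - b n) = (fun n => - psum b n).
    by apply/funext => n; rewrite /psum sumrN.
  exact: cvgN.
have qCN n : `|- q n| <= C by rewrite normrN.
have h1 := renewal_le qE bB qC e0; have h2 := renewal_le qN bN qCN e0.
near=> n.
have u1 : q n <= B / mu + e by near: n.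
have u2 : - q n <= - B / mu + e by near: n; exact: h2.
by rewrite ler_norml; apply/andP; split; lra.
Unshelve. all: by end_near. Qed.

End RenewalTheorem.
End Renewal.

(** * Convergence of series with submultiplicative coefficients *)

Section PowerSeries.
Variable R : realType.
Implicit Types (a b : nat -> R) (z r : R).

Definition pterm a z n : R := a n * z ^+ n.

Lemma pterm_ge0 a z n : (forall n, 0 <= a n) -> 0 <= z -> 0 <= pterm a z n.
Proof. by move=> a0 z0; rewrite mulr_ge0 ?exprn_ge0. Qed.

Lemma ler_pterm a z r n : (forall n, 0 <= a n) -> 0 <= z -> z <= r ->
  pterm a z n <= pterm a r n.
Proof. by move=> a0 z0 zr; rewrite ler_wpM2l// lerXn2r// nnegrE (le_trans z0). Qed.

Lemma pterm_cauchy a b z : pterm (cauchy_prod a b) z = cauchy_prod (pterm a z) (pterm b z).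
Proof.
apply/funext => n; rewrite /pterm /cauchy_prod mulr_suml; apply: eq_bigr => k _.
have -> : z ^+ n = z ^+ k * z ^+ (n - k) by rewrite -exprD subnKC ?leq_ord.
ring.
Qed.

Lemma psum_pterm_continuous a n : continuous (fun z => psum (pterm a z) n).
Proof.
have -> : (fun z => psum (pterm a z) n) = horner (\poly_(k < n) a k).
  by apply/funext => z; rewrite horner_poly.
exact: continuous_horner.
Qed.

Lemma psum_cauchy a b n :
  psum (cauchy_prod a b) n.+1 = cauchy_prod a (fun k => psum b k.+1) n.
Proof.
elim: n => [|n IH]; first by rewrite /cauchy_prod /psum !big_ord1 /=.
rewrite psumS IH [cauchy_prod a b _]/cauchy_prod big_ord_recr addrA.
rewrite [in RHS]/cauchy_prod [RHS]big_ord_recr /= !subnn.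
have -> : psum b 1 = b 0%N by rewrite /psum big_ord1.
congr (_ + _).
rewrite -big_split; apply: eq_bigr => k _ /=.
by rewrite subSn ?leq_ord// [in RHS]psumS mulrDr.
Qed.

Lemma psumM_le a b n : (forall k, 0 <= a k) -> (forall k, 0 <= b k) ->
  psum a n * psum b n <= psum (cauchy_prod a b) (n + n).+1.
Proof.
move=> a0 b0; rewrite psum_cauchy /cauchy_prod {1}/psum mulr_suml.
rewrite (big_ord_widen _ (fun k => a k * psum b n) (leq_addr n.+1 n)).
rewrite addnS big_mkcond; apply: ler_sum => k _; case: ifPn => kn.
  by rewrite ler_wpM2l// psum_nondecreasing//; lia.
by rewrite mulr_ge0// psum_ge0.
Qed.

Definition submult a := forall m n, a (m + n)%N <= a m * a n.
(** For a submultiplicative sequence this is equivalent to convergence at [z]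
    ([subcritical_bounded], [bounded_subcritical]); in this form it is visibly an
    open condition. *)
Definition subcritical a z := exists2 m, (0 < m)%N & pterm a z m < 1.

(** With [w] for the terms, the sum of the terms from [m] on is at most [w m]
    times the whole sum, which gives a geometric bound. *)
Lemma subcritical_bounded a z : (forall n, 0 <= a n) -> 0 <= z -> submult a ->
  subcritical a z -> exists M, forall n, psum (pterm a z) n <= M.
Proof.
move=> a0 z0 sa [m m0 am].
have w0 n : 0 <= pterm a z n by apply: pterm_ge0.
exists (psum (pterm a z) m / (1 - pterm a z m)) => n.
rewrite ler_pdivlMr ?subr_gt0// mulrBr mulr1 lerBlDr.
apply: (le_trans (psum_nondecreasing w0 (leq_addl m n))).
rewrite psumD lerD2l mulr_suml; apply: ler_sum => k _.
by rewrite [leRHS]mulrC /pterm [leRHS]mulrACA -exprD ler_wpM2r// exprn_ge0.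
Qed.

Lemma bounded_subcritical a z M : (forall n, 0 <= a n) -> 0 <= z ->
  (forall n, psum (pterm a z) n <= M) -> subcritical a z.
Proof.
move=> a0 z0 aM; apply: contrapT => nH.
have w1 n : 1 <= pterm a z n.+1.
  by rewrite leNgt; apply/negP => an; apply: nH; exists n.+1.
have wn n : n%:R <= psum (pterm a z) n.+1.
  elim: n => [|n IH]; first by apply: psum_ge0 => k; apply: pterm_ge0.
  by rewrite psumS -natr1 lerD.
have := aM (Num.Def.archi_bound M).+1; apply/negP; rewrite -ltNge.
apply: lt_le_trans (wn _); apply: archi_boundP.
by apply: le_trans (aM 0%N); apply: psum_ge0 => k; apply: pterm_ge0.
Qed.

Lemma subcritical_near a z : subcritical a z -> \forall r \near z, subcritical a r.
Proof.
move=> [m m0 am].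
have c : (fun r => pterm a r m) @ z --> pterm a z m.
  by apply: cvgM; [exact: cvg_cst|exact: exprn_continuous].
by near=> r; exists m => //; near: r; apply: (cvgr_lt _ c).
Unshelve. all: by end_near. Qed.

Lemma subcritical_le a z r : (forall n, 0 <= a n) -> 0 <= z -> z <= r ->
  subcritical a r -> subcritical a z.
Proof.
by move=> a0 z0 zr [m m0 am]; exists m => //; apply: le_lt_trans am; apply: ler_pterm.
Qed.

Lemma near_gt (P : R -> Prop) z : (\forall r \near z, P r) ->
  forall y, z < y -> exists2 r, z < r < y & P r.
Proof.
move=> Pz y zy; have [e /= e0 He] := Pz.
exists (z + Num.min (e / 2) ((y - z) / 2)).
  by rewrite ltrDl lt_min !divr_gt0 ?subr_gt0//= -ltrBrDl gt_min; apply/orP; right; lra.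
apply: He; rewrite /= opprD addNKr normrN.
by rewrite ger0_norm ?le_min ?divr_ge0 ?ltW ?subr_gt0// gt_min; apply/orP; left; lra.
Qed.

Lemma le_at_sup (E : set R) (f : R -> R) c : has_sup E -> continuous f ->
  (forall z, E z -> f z <= c) -> f (sup E) <= c.
Proof.
move=> sE cf fE; rewrite leNgt; apply/negP => cl.
have [e /= e0 He] := cvgr_gt _ (cf (sup E)) _ cl.
have [z Ez zl] := sup_adherent e0 sE.
have zs := ub_le_sup sE.2 Ez.
suff : c < f z by rewrite ltNge fE.
by apply: He; rewrite /= ger0_norm ?subr_ge0//; lra.
Qed.

End PowerSeries.

(** In the application, [A] counts the elements without syllables of [v0], [V] the
    vertex group, [X] its nontrivial elements and [T] the separators. *)
Section Radius.
Variables (R : realType) (A V X T : nat -> R) (c : R) (M : nat).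
Hypotheses (A_ge0 : forall n, 0 <= A n) (V_ge0 : forall n, 0 <= V n).
Hypotheses (X_ge0 : forall n, 0 <= X n) (T_ge0 : forall n, 0 <= T n).
Hypothesis VX : forall n, V n.+1 = X n.+1.
Hypothesis c_ge0 : 0 <= c.
Hypothesis AT : forall n, A n.+1 <= c * \sum_(j < M) T (n.+1 + j)%N.
Hypotheses (X_1 : 1 <= X 1%N) (T_1 : 1 <= T 1%N) (T_2 : 1 <= T 2%N).

(** The shift by [j] in the bound of [A] by [T] costs a factor [z ^- j], which is
    at most [z ^- M]. *)
Lemma psum_shift_bound z N : 0 < z -> z <= 1 ->
  forall D, (forall n, psum (pterm T z) n <= D) ->
  psum (pterm A z) N <= A 0%N + c * (M%:R * (z ^- M * D)).
Proof.
move=> z0 z1 D TD.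
have z0' := ltW z0.
have D0 : 0 <= D by apply: le_trans (TD 0%N); apply: psum_ge0 => k; apply: pterm_ge0.
apply: (le_trans (psum_nondecreasing (fun n => pterm_ge0 n A_ge0 z0') (leqnSn N))).
rewrite -add1n psumD {1}/psum big_ord1 {1}/pterm expr0 mulr1 lerD2l.
apply: (@le_trans _ _ (c * \sum_(j < M) (z ^- M *
    psum (fun k => pterm T z (1 + j + k)%N) N))).
  rewrite /psum. under [in leRHS]eq_bigr do rewrite mulr_sumr.
  rewrite exchange_big mulr_sumr; apply: ler_sum => k _ /=.
  rewrite /pterm add1n; apply: (le_trans (ler_wpM2r _ (AT k))); first exact: exprn_ge0.
  rewrite -mulrA ler_wpM2l// mulr_suml; apply: ler_sum => j _.
  have -> : (1 + j + k = k.+1 + j)%N by lia.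
  have -> : z ^- M * (T (k.+1 + j)%N * z ^+ (k.+1 + j)) =
      T (k.+1 + j)%N * (z ^+ k.+1 * (z ^- M * z ^+ j)) by rewrite exprD; ring.
  rewrite ler_wpM2l// ler_peMr ?exprn_ge0//.
  by rewrite ler_pdivlMl ?exprn_gt0// mulr1 ler_wiXn2l// ltnW.
rewrite ler_wpM2l//; apply: (@le_trans _ _ (\sum_(j < M) (z ^- M * D))).
  apply: ler_sum => j _.
  rewrite ler_wpM2l ?invr_ge0 ?exprn_ge0//; apply: le_trans (TD (1 + j + N)%N).
  by rewrite psumD lerDr; apply: psum_ge0 => k; apply: pterm_ge0.
by rewrite sumr_const card_ord mulr_natl.
Qed.

(** The connectedness argument: the set [E] of points of [0, 1] where both series
    converge is open in [0, 1] and an interval.  If the conclusion failed, [X] and [T]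
    would be bounded on [E], since their product is at most 1 and each is at
    least [z1]; then [A] and [V] would be bounded, so the supremum [r] of [E] would
    belong to [E] and be equal to 1.  But at 1 the product is at least 2. *)
Lemma renewal_sum_gt1 : exists2 z, 0 <= z <= 1 &
  [/\ subcritical A z, subcritical V z & exists n, 1 < psum (pterm (cauchy_prod X T) z) n].
Proof.
apply: contrapT => nH.
pose E := [set z | [/\ 0 <= z <= 1, subcritical A z & subcritical V z]].
have U1 z : E z -> forall n, psum (pterm (cauchy_prod X T) z) n <= 1.
  move=> [z01 Az Vz] n; rewrite leNgt; apply/negP => zn; apply: nH.
  by exists z => //; split=> //; exists n.
have E0 : E 0.
  by split; [lra|exists 1%N|exists 1%N]; rewrite ?/pterm ?expr1 ?mulr0 ?ltr01.
have sE : has_sup E by split; [exists 0|exists 1 => z [/andP[]]].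
pose r := sup E.
have Eb z : 0 <= z <= 1 -> z < r -> E z.
  move=> z01 zr; have rz : 0 < r - z by lra.
  have [y [/andP[y0 y1] Ay Vy] ry] := sup_adherent rz sE.
  have zy : z <= y by move: ry; rewrite -/r; lra.
  by case/andP: (z01) => z0 _; split=> //;
    [apply: subcritical_le zy Ay|apply: subcritical_le zy Vy].
have r1 : r <= 1 by apply: ge_sup; [exists 0|move=> z [/andP[]]].
have step z : E z -> z < 1 -> exists2 y, z < y & E y.
  move=> [/andP[z0 z1] Az Vz] zl1.
  have [y /andP[zy y1] [Ay Vy]] :=
    near_gt (filterI (subcritical_near Az) (subcritical_near Vz)) zl1.
  by exists y => //; split=> //; apply/andP; split; lra.
(* A positive point of [E], to keep the bounds away from the singularity at 0. *)
have [z1 z10 Ez1] := step 0 E0 ltr01.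
have [/andP[_ z11] _ _] := Ez1.
have z1r : z1 <= r by exact: (ub_le_sup sE.2 Ez1).
have XT z : z1 <= z -> E z -> forall n, psum (pterm X z) n * psum (pterm T z) n <= 1.
  move=> zz1 Ez n; have [/andP[z0 _] _ _] := Ez.
  apply: le_trans (U1 z Ez (n + n).+1); rewrite pterm_cauchy; apply: psumM_le => k;
  exact: pterm_ge0.
have lower (B : nat -> R) z n : (forall n, 0 <= B n) -> 1 <= B 1 -> z1 <= z ->
    z1 <= psum (pterm B z) n.+2.
  move=> B0 B1 zz1; have z0 : 0 <= z by lra.
  apply: (le_trans zz1); apply: le_trans (@psum_term_le _ _ 1 _ _ _) => //.
    by rewrite /pterm expr1 ler_peMl.
  by move=> k; apply: pterm_ge0.
have bnd (B B' : nat -> R) z : (forall n, 0 <= B n) -> (forall n, 0 <= B' n) ->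
    1 <= B 1 -> z1 <= z ->
    (forall n, psum (pterm B z) n * psum (pterm B' z) n <= 1) ->
    forall n, psum (pterm B' z) n <= z1^-1.
  move=> B0 B'0 B1 zz1 BB n; have z0 : 0 <= z by lra.
  have w' k : 0 <= pterm B' z k by apply: pterm_ge0.
  apply: (@le_trans _ _ (psum (pterm B' z) n.+2)).
    by apply: psum_nondecreasing => //; lia.
  have p0 := psum_ge0 n.+2 w'.
  rewrite -[leRHS]mul1r ler_pdivlMr// mulrC; apply: le_trans (BB n.+2).
  by rewrite ler_wpM2r// lower.
have Tb z : z1 <= z -> E z -> forall n, psum (pterm T z) n <= z1^-1.
  by move=> zz1 Ez; apply: (bnd X) => //; apply: XT.
have Xb z : z1 <= z -> E z -> forall n, psum (pterm X z) n <= z1^-1.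
  by move=> zz1 Ez; apply: (bnd T) => // n; rewrite mulrC; apply: XT.
pose DA := A 0%N + c * (M%:R * (z1 ^- M * z1^-1)).
have Ab n z : E z -> psum (pterm A z) n <= DA.
  move=> Ez; have [/andP[z0 zl1] _ _] := Ez.
  have [z1z|zz1] := leP z1 z.
    have zp : 0 < z by lra.
    apply: (le_trans (psum_shift_bound n zp zl1 (Tb z z1z Ez))).
    rewrite lerD2l ler_wpM2l// ler_wpM2l// ler_wpM2r ?invr_ge0 ?(ltW z10)//.
    by rewrite lef_pV2 ?posrE ?exprn_gt0// lerXn2r ?nnegrE// ltW.
  apply: (@le_trans _ _ (psum (pterm A z1) n)).
    by apply: ler_psum => k; apply: ler_pterm => //; exact: ltW.
  exact: (psum_shift_bound n z10 z11 (Tb z1 (lexx _) Ez1)).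
pose DV := V 0%N + z1^-1.
have Vb n z : E z -> psum (pterm V z) n <= DV.
  move=> Ez.
  have VXb y : z1 <= y -> E y -> psum (pterm V y) n <= DV.
    move=> z1y Ey; have y0 : 0 <= y by lra.
    apply: (le_trans (psum_nondecreasing (fun n => pterm_ge0 n V_ge0 y0) (leqnSn n))).
    rewrite -add1n psumD {1}/psum big_ord1 {1}/pterm expr0 mulr1 lerD2l.
    apply: le_trans (Xb y z1y Ey n.+1).
    rewrite -[in leRHS](add1n n) psumD -[leLHS]add0r lerD//.
      by apply: psum_ge0 => k; apply: pterm_ge0.
    by apply: ler_psum => k; rewrite /pterm add1n VX.
  have [z1z|zz1] := leP z1 z; first exact: VXb.
  apply: le_trans (VXb z1 (lexx _) Ez1).
  by have [/andP[z0 _] _ _] := Ez; apply: ler_psum => k; apply: ler_pterm => //; exact: ltW.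
have r0 : 0 <= r by lra.
have Er : E r.
  split; first by rewrite r0.
  - apply: (@bounded_subcritical _ _ _ DA) => // n.
    exact: (le_at_sup sE (@psum_pterm_continuous _ A n) (Ab n)).
  - apply: (@bounded_subcritical _ _ _ DV) => // n.
    exact: (le_at_sup sE (@psum_pterm_continuous _ V n) (Vb n)).
have [rl1|r1'] := ltP r 1.
  have [y ry Ey] := step r Er rl1.
  by have := ub_le_sup sE.2 Ey; rewrite leNgt ry.
have rE : r = 1 by apply/le_anti/andP.
have eval (B : nat -> R) : psum (pterm B r) 3 = B 0%N + B 1%N + B 2%N.
  by rewrite rE /psum !big_ord_recr big_ord0 /= /pterm !expr1n !mulr1 add0r.
have := XT r z1r Er 3%N; rewrite !eval.
have X3 : 1 <= X 0%N + X 1%N + X 2%N by rewrite ler_wpDr// ler_wpDl.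
have T3 : 1 + 1 <= T 0%N + T 1%N + T 2%N by rewrite lerD// ler_wpDl.
move/(le_trans (ler_pM ler01 (addr_ge0 ler01 ler01) X3 T3)).
by rewrite mul1r leNgt ltrDl ltr01.
Qed.

End Radius.

(** * Exact growth from a renewal equation *)

Section Growth.
Variable R : realType.

(** The root is the largest [r] at which all partial sums are at most 1: if the sum
    were below 1 there, continuity of a partial sum and the uniformly small
    remainder up to [z] would allow a larger [r]. *)
Lemma renewal_radius (U : nat -> R) z : (forall n, 0 <= U n) -> U 0%N = 0 ->
  0 <= z -> cvgn (psum (pterm U z)) -> (exists n, 1 < psum (pterm U z) n) ->
  exists2 r, 0 < r < z & psum (pterm U r) @ \oo --> (1 : R).
Proof.
move=> U0 U00 z0 cz [N HN].
pose E := [set y | 0 <= y <= z /\ forall n, psum (pterm U y) n <= 1].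
have E0 : E 0.
  split=> [|n]; first by rewrite lexx.
  rewrite [psum _ _]big1 ?ler01// => -[[|k] /= _] _; rewrite /pterm ?U00 ?mul0r//.
  by rewrite expr0n mulr0.
have sE : has_sup E by split; [exists 0|exists z => y [/andP[]]].
pose r := sup E.
have r1 n : psum (pterm U r) n <= 1.
  by apply: (le_at_sup sE (@psum_pterm_continuous _ U n)) => y [_ +]; apply.
have r0 : 0 <= r by exact: (ub_le_sup sE.2 E0).
have rz : r < z.
  rewrite lt_neqAle; apply/andP; split.
    by apply/eqP => rz; have := r1 N; rewrite rz leNgt HN.
  by apply: ge_sup; [exists 0|move=> y [/andP[]]].
have w0 k : 0 <= pterm U r k by apply: pterm_ge0.
have cr : cvgn (psum (pterm U r)) by apply: psum_cvg r1.
have wz k : 0 <= pterm U z k by apply: pterm_ge0.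
have lim1 : limn (psum (pterm U r)) = 1.
  apply/le_anti/andP; split; first by apply: limr_le => //; near=> n.
  rewrite leNgt; apply/negP => l1; set l := limn _ in l1.
  have e0 : 0 < (1 - l) / 2 by lra.
  have [K HK] := small_tail wz cz e0.
  have lt1 : psum (pterm U r) K.+1 < (1 + l) / 2.
    by apply: le_lt_trans (psum_le_lim _ w0 cr) _; rewrite -/l; lra.
  have [y /andP[ry yz] Hy] :=
    near_gt (cvgr_lt _ (@psum_pterm_continuous _ U K.+1 r) _ lt1) rz.
  have y0 : 0 <= y by lra.
  suff Ey : E y by have := ub_le_sup sE.2 Ey; rewrite leNgt ry.
  split=> [|n]; first by rewrite y0 ltW.
  apply: (@le_trans _ _ (psum (pterm U y) (K.+1 + n))).
    by apply: psum_nondecreasing; [move=> k; apply: pterm_ge0|exact: leq_addl].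
  rewrite psumD.
  suff : psum (fun k => pterm U y (K.+1 + k)) n <= (1 - l) / 2 by move: Hy => /=; lra.
  apply: le_trans (HK (K.+1 + n)%N).
  have -> : \sum_(k < K.+1 + n | (K < k)%N) pterm U z k =
      psum (fun k => if (K < k)%N then pterm U z k else 0) (K.+1 + n).
    by rewrite big_mkcond.
  rewrite psumD -[leLHS]add0r lerD//.
    by apply: psum_ge0 => k; case: ifP.
  by apply: ler_psum => k; rewrite leq_addr; apply: ler_pterm => //; exact: ltW.
exists r; last by rewrite -lim1.
rewrite rz andbT lt_neqAle r0 andbT; apply/eqP => r00.
have : limn (psum (pterm U r)) <= 0; last by rewrite lim1 ler10.
apply: limr_le => //; near=> n; rewrite [psum _ _]big1// -r00 => -[[|k] /= _] _.
  by rewrite /pterm U00 mul0r.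
by rewrite /pterm expr0n mulr0.
Unshelve. all: by end_near. Qed.

(** The tails at [r] decay geometrically, with ratio [r / z], because the series
    still converges at [z]. *)
Lemma tail_bounded (U : nat -> R) r z D : (forall n, 0 <= U n) -> 0 <= r -> r < z ->
  (forall n, psum (pterm U z) n <= D) -> psum (pterm U r) @ \oo --> (1 : R) ->
  exists M, forall n, psum (tail (pterm U r)) n <= M.
Proof.
move=> U0 r0 rz UD Ur.
have z0 : 0 < z by exact: le_lt_trans rz.
pose t := r / z.
have t0 : 0 <= t by rewrite divr_ge0// ltW.
have t1 : t < 1 by rewrite ltr_pdivrMr// mul1r.
have wz k : 0 <= pterm U z k by apply: pterm_ge0 => //; exact: ltW.
have wr k : 0 <= pterm U r k by apply: pterm_ge0.
have D0 : 0 <= D by apply: le_trans (UD 0%N); apply: psum_ge0.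
have wE k : pterm U r k = t ^+ k * pterm U z k.
  by rewrite /pterm /t expr_div_n; field; rewrite expf_neq0// gt_eqF.
have tb k : tail (pterm U r) k <= D * pterm (fun=> 1) t k.
  rewrite /tail lerBlDl; apply: (cvgr_to_le Ur); near=> n.
  apply: (le_trans (psum_nondecreasing wr (leq_addl k.+1 n))).
  rewrite psumD lerD2l; apply: le_trans (_ : t ^+ k * psum (pterm U z) (k.+1 + n) <= _).
    rewrite psumD mulrDr -[leLHS]add0r lerD ?mulr_ge0 ?exprn_ge0 ?psum_ge0//.
    rewrite /psum mulr_sumr; apply: ler_sum => j _; rewrite wE ler_wpM2r//.
    by rewrite ler_wiXn2l ?(ltW t1)//; lia.
  by rewrite /pterm mul1r mulrC ler_wpM2r ?exprn_ge0.
have [] := @subcritical_bounded _ (fun=> 1) t _ t0.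
- by move=> _; exact: ler01.
- by move=> m n; rewrite mulr1.
- by exists 1%N => //; rewrite /pterm mul1r.
move=> M HM; exists (D * M) => n; apply: le_trans (_ : D * psum (pterm (fun=> 1) t) n <= _).
  by rewrite /psum mulr_sumr; apply: ler_sum => k _.
by rewrite ler_wpM2l.
Unshelve. all: by end_near. Qed.

Lemma psum_cauchy_le (a b : nat -> R) n : (forall k, 0 <= a k) -> (forall k, 0 <= b k) ->
  psum (cauchy_prod a b) n <= psum a n * psum b n.
Proof.
move=> a0 b0; case: n => [|n]; first by rewrite /psum !big_ord0 mul0r.
rewrite psum_cauchy /cauchy_prod /psum mulr_suml; apply: ler_sum => k _.
by rewrite ler_wpM2l// -/(psum _ _) psum_nondecreasing// ltnS leq_subr.
Qed.

Theorem renewal_growth (A V X T Q : nat -> R) (c : R) (M : nat) :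
  (forall n, 0 <= A n) -> (forall n, 0 <= V n) -> (forall n, 0 <= X n) ->
  (forall n, 0 <= T n) -> (forall n, 0 <= Q n) ->
  submult A -> submult V -> (forall n, V n.+1 = X n.+1) ->
  0 <= c -> (forall n, A n.+1 <= c * \sum_(j < M) T (n.+1 + j)%N) ->
  1 <= X 1%N -> 1 <= T 1%N -> 1 <= T 2%N -> X 0%N = 0 -> T 0%N = 0 ->
  0 < A 0%N -> 0 < V 0%N ->
  (forall n, T n <= A n) ->
  (forall n, Q n = V n + cauchy_prod (cauchy_prod X T) Q n) ->
  exists lambda l : R, [/\ 1 < lambda, 0 < l &
    (fun n => cauchy_prod A Q n / lambda ^+ n) @ \oo --> l].
Proof.
move=> A0 V0 X0 T0 Q0 As Vs VX c0 AT X1 T1 T2 X00 T00 A00 V00 TA QE.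
have [z /andP[z0 z1] [Az Vz [N HN]]] :=
  renewal_sum_gt1 A0 V0 X0 T0 VX c0 AT X1 T1 T2.
have [DA HA] := subcritical_bounded A0 z0 As Az.
have [DV HV] := subcritical_bounded V0 z0 Vs Vz.
have XV n : X n <= V n by case: n => [|n]; [rewrite X00 ltW|rewrite VX].
pose U := cauchy_prod X T.
have U0 n : 0 <= U n by apply: sumr_ge0 => k _; rewrite mulr_ge0.
have U00 : U 0%N = 0 by rewrite /U /cauchy_prod big_ord1 X00 mul0r.
have U2 : 0 < U 2%N.
  rewrite /U /cauchy_prod !big_ord_recr big_ord0 /= X00 T00 mul0r mulr0 !addr0 add0r.
  by rewrite mulr_gt0// (lt_le_trans ltr01).
have U3 : 0 < U 3%N.
  rewrite /U /cauchy_prod !big_ord_recr big_ord0 /= X00 T00 mul0r mulr0 !addr0 add0r.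
  by rewrite ltr_wpDr ?mulr_ge0// mulr_gt0// (lt_le_trans ltr01).
have wz a n : (forall n, 0 <= a n) -> 0 <= pterm a z n by move=> a0; apply: pterm_ge0.
have UD n : psum (pterm U z) n <= DV * DA.
  rewrite pterm_cauchy; apply: (le_trans (psum_cauchy_le _ _ _)) => [k|k|]; try exact: wz.
  apply: ler_pM; try by apply: psum_ge0 => k; apply: wz.
    by apply: le_trans (HV n); apply: ler_psum => k; rewrite ler_wpM2r ?exprn_ge0.
  by apply: le_trans (HA n); apply: ler_psum => k; rewrite ler_wpM2r ?exprn_ge0.
have [||r /andP[r0 rz] p1] := @renewal_radius U z U0 U00 z0.
- by apply: psum_cvg UD => k; apply: wz.
- by exists N.
have r0' := ltW r0.
have wr a n : (forall n, 0 <= a n) -> 0 <= pterm a r n by move=> a0; apply: pterm_ge0.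
have rbound a D : (forall n, 0 <= a n) -> (forall n, psum (pterm a z) n <= D) ->
    forall n, psum (pterm a r) n <= D.
  move=> a0 aD n; apply: le_trans (aD n).
  by apply: ler_psum => k; apply: ler_pterm => //; exact: ltW.
have [M' HM'] := tail_bounded U0 r0' rz UD p1.
have p_le1 n : psum (pterm U r) n <= 1.
  by rewrite -(cvg_lim _ p1)//; apply: psum_le_lim (cvgP _ p1) => k; apply: wr.
have t0 n : 0 <= tail (pterm U r) n by rewrite subr_ge0.
have tc := psum_cvg t0 HM'.
have wU0 : pterm U r 0%N = 0 by rewrite /pterm U00 mul0r.
have tail0 : tail (pterm U r) 0 = 1 by rewrite /tail /psum big_ord1 wU0 subr0.
have bc : cvgn (psum (pterm V r)) by apply: psum_cvg (rbound _ _ V0 HV) => k; apply: wr.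
have Ac : cvgn (psum (pterm A r)) by apply: psum_cvg (rbound _ _ A0 HA) => k; apply: wr.
have qE n : pterm Q r n = pterm V r n + cauchy_prod (pterm U r) (pterm Q r) n.
  by rewrite -pterm_cauchy /pterm QE mulrDl.
have qC n : `|pterm Q r n| <= DV.
  rewrite ger0_norm ?wr//; apply: le_trans (rbound _ _ V0 HV n.+1).
  rewrite -(tail_cauchy wU0 qE) /cauchy_prod big_ord_recl tail0 mul1r subn0 lerDl.
  by apply: sumr_ge0 => k _; rewrite mulr_ge0// wr.
have wU k : (0 < U k) -> 0 < pterm U r k by move=> Uk; rewrite /pterm mulr_gt0// exprn_gt0.
have ql := renewal_theorem (fun n => wr _ n U0) wU0 (wU _ U2) (wU _ U3) p1 tc qE bc qC.
have lim_gt0 (a : nat -> R) : (forall n, 0 <= a n) -> 0 < a 0%N ->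
    cvgn (psum a) -> 0 < limn (psum a).
  move=> a0 a00 ca; apply: lt_le_trans (psum_le_lim 1 a0 ca).
  by rewrite /psum big_ord1.
have al := cauchy_prod_cvg (fun n => wr A n A0) Ac qC ql.
exists r^-1,
  (limn (psum (pterm A r)) * (limn (psum (pterm V r)) / limn (psum (tail (pterm U r))))).
split.
- by rewrite invf_gt1//; apply: lt_le_trans rz z1.
- rewrite mulr_gt0 ?divr_gt0//; apply: lim_gt0 => //.
  + by move=> k; apply: wr.
  + by rewrite /pterm expr0 mulr1.
  + by move=> k; apply: wr.
  + by rewrite /pterm expr0 mulr1.
  + by rewrite tail0.
- rewrite -pterm_cauchy in al; apply: cvg_trans al.
  by apply: near_eq_cvg; near=> n; rewrite /pterm exprVn invrK.
Unshelve. all: by end_near. Qed.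
End Growth.

Theorem theorem11p2 (R : realType) (V : finType) (adj : rel V)
    (G : V -> groupType) (S : forall v : V, set (G v)) :
  simplicial_graph adj ->
  (forall v : V, exists g : G v, g <> 1%g) ->
  (forall v : V, admissible_wrt (S v)) ->
  anticonnected adj ->
  (3 <= #|V|)%N ->
  exists lambda c : R,
    [/\ 1 < lambda, 0 < c &
        (fun n : nat =>
           (#|` fset_set (sphere (standard_generators adj S) n)|)%fset%:R
             / lambda ^+ n) @ \oo --> c].
Proof.
move=> [adj_sym adj_irr] nontrivial adm anticon V3.
have S_fin v : finite_set (S v) by case: (adm v).
have S_gen v : generates (S v) by case: (adm v).
have letter1_ex v : exists s, wlen (S_gen v) s = 1%N.
  have [g g1] := nontrivial v; case E : (wlen (S_gen v) g) => [|n].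
    by case: g1; apply: wlen_eq0 E.
  by have [s [_ [s1 _ _]]] := wlen_split E; exists s.
pose letter1 v := sval (cid (letter1_ex v)).
have letter1_len v : wlen (S_gen v) (letter1 v) = 1%N := svalP (cid (letter1_ex v)).
have /card_gt0P[v0 _] : (0 < #|V|)%N := ltnW (ltnW V3).
have [w [u [wv vw uv uw H]]] := anticonnected_neighbours v0 anticon V3.
(* Any vertex can play the role of [v0]. *)
pose SG := standard_generators adj S.
have SG_fin : finite_set SG := standard_finite adj S_fin.
have SG_gen : generates SG := standard_generates adj_sym adj_irr S_gen.
pose f (Y : set (gprod adj G)) n : R := (cnt SG Y n)%:R.
have f0 Y n : 0 <= f Y n by exact: ler0n.
have f_cauchy X Y Z :
    (forall n, cnt SG Z n = \sum_(k < n.+1) cnt SG X k * cnt SG Y (n - k))%N ->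
    f Z = cauchy_prod (f X) (f Y).
  move=> ZE; apply/funext => n; rewrite /f ZE natr_sum.
  by apply: eq_bigr => k _; rewrite natrM.
have f_submult B : submult (f (special B)).
  move=> m n; rewrite /f -natrM ler_nat.
  by rewrite (cnt_special_submult adj_sym adj_irr S_fin S_gen).
have cnt1 Y : Y 1%g -> 0 < f Y 0%N.
  move=> Y1; rewrite ltr0n; have := cnt_gt0 SG_fin SG_gen Y1.
  by rewrite wlen1.
have [] := @renewal_growth R (f (vertex_free v0)) (f (vertex_group v0))
  (f (vertex_syllable v0)) (f (separator v0))
  (f (vertex_headed v0)) (#|V| ^ (#|V| * #|V|))%:R (#|V| * #|V|).+1
  (f0 _) (f0 _) (f0 _) (f0 _) (f0 _) (f_submult _) (f_submult _).
- by move=> n; rewrite /f (cnt_vertex_groupS adj_sym adj_irr S_fin S_gen).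
- exact: ler0n.
- move=> n; rewrite /f -natr_sum -natrM ler_nat.
  exact: (cnt_vertex_free_le adj_sym adj_irr S_fin v0 letter1_len).
- by rewrite ler1n (cnt_vertex_syllable1 adj_sym adj_irr S_fin v0 letter1_len).
- by rewrite ler1n (cnt_separator1 adj_sym adj_irr S_fin letter1_len wv vw).
- by rewrite ler1n (cnt_separator2 adj_sym adj_irr S_fin letter1_len wv vw uv uw H).
- by rewrite /f (cnt_eq0 adj_sym adj_irr S_fin S_gen) // => -[].
- by rewrite /f (cnt_eq0 adj_sym adj_irr S_fin S_gen) // => -[].
- by apply: cnt1; apply: (special1 adj_sym adj_irr).
- by apply: cnt1; apply: (special1 adj_sym adj_irr).
- move=> n; rewrite ler_nat; apply: (cnt_le SG_fin (gen := SG_gen)) => x _; by case.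
- move=> n; rewrite /f (cnt_vertex_headed adj_sym adj_irr S_fin S_gen) natrD; congr (_ + _).
  rewrite -/(f _ n) (f_cauchy _ _ _ (cnt_block_headed adj_sym adj_irr S_fin S_gen v0)).
  by rewrite (f_cauchy _ _ _ (cnt_block adj_sym adj_irr S_fin S_gen v0)).
move=> lambda [c [lambda1 c0 lim]]; exists lambda, c; split=> //.
rewrite -(f_cauchy _ _ _ (cnt_setT adj_sym adj_irr S_fin S_gen v0)) in lim.
have fE n : f setT n = (#|` fset_set (sphere SG n)|)%fset%:R.
  by rewrite /f /cnt /slice setTI.
by under eq_fun do rewrite -fE.
Qed.
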